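(* Let $k$ be an even integer. (i) If $k \geq 10$, then every zero of $E_k^2(\tau) + E_{2k}(\tau)$ in the fundamental domain $\mathcal{F}$ lies on the arc $\mathcal{A} = \{e^{i\theta} : \pi/2 \leq \theta \leq 2\pi/3\}$. (ii) If $k \geq 16$, then every zero of $E_k^3(\tau) + E_{3k}(\tau)$ in the fundamental domain $\mathcal{F}$ lies on the arc $\mathcal{A}$.
   Context: For an even integer $k \geq 4$ and $\tau$ in the upper half plane $\mathbb{H}=\{\tau\in\mathbb{C}: \operatorname{Im}(\tau)>0\}$, the normalized Eisenstein series of weight $k$ for $\mathrm{SL}_2(\mathbb{Z})$ is $$E_k(\tau) = \frac12 \sum_{\substack{c,d\in\mathbb{Z}\\ \gcd(c,d)=1}} (c\tau+d)^{-k}.$$ $E_k^n(\tau)$ denotes the power $(E_k(\tau))^n$. The standard fundamental domain is $$\mathcal{F}=\left\{\tau\in\mathbb{H}: |\tau|>1,\ 0<\operatorname{Re}(\tau)<\tfrac12\right\}\cup\left\{\tau\in\mathbb{H}: |\tau|\geq 1,\ -\tfrac12\leq\operatorname{Re}(\tau)\leq 0\right\}.$$ *)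

(* Defs.v *)
From mathcomp Require Import all_boot all_order all_algebra.
From mathcomp Require Import complex.
From mathcomp Require Import all_classical all_reals all_analysis.
From mathcomp Require summability.

Set Implicit Arguments.
Unset Strict Implicit.
Unset Printing Implicit Defensive.

Import Order.TTheory GRing.Theory Num.Theory.
Import numFieldNormedType.Exports.

Local Open Scope classical_set_scope.
Local Open Scope ring_scope.
Local Open Scope complex_scope.

Definition coprime_pair := {p : int * int | coprimez p.1 p.2}.

(* [summability.sum] is the unordered sum: the limit of the finite partial sums
   along the filter of finite sets of indices ordered by inclusion. It is
   meaningful here for k >= 3 and Im tau > 0, where the series converges
   absolutely. The regular module [R[i]^o] carries the topology of the
   modulus. *)
Definition eisenstein (R : realType) (k : nat) (tau : R[i]) : R[i] :=
  (2^-1 : R[i]) * summability.sum (R := R[i]^o) (fun p : coprime_pair =>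
    ((val p).1%:~R * tau + (val p).2%:~R) ^- k).

Definition upper_half_plane (R : realType) : set R[i] :=
  [set tau | 0 < complex.Im tau].

(* The order of [R[i]] compares complex numbers with equal imaginary parts, so
   below it is the usual order on the real numbers [1] and [`|tau|]. *)
Definition fundamental_domain (R : realType) : set R[i] :=
  [set tau | upper_half_plane tau /\
     (1 < `|tau| /\ 0 < complex.Re tau < 2^-1)] `|`
  [set tau | upper_half_plane tau /\
     (1 <= `|tau| /\ - 2^-1 <= complex.Re tau <= 0)].

Definition unit_arc (R : realType) : set R[i] :=
  [set cos theta +i* sin theta | theta in `[pi / 2, 2 * pi / 3]].

(* Main.v *)
(** Let [G_w] be the lattice sum over nonzero [c tau + d], so that [E_w = G_w / (2 zeta(w))].
    Partial fractions of [1/(p^a q^b)] with [p + q + r = 0], summed over lattice points,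
    give a recursion expressing every [G_w] as a polynomial in [G_4] and [G_6].
    Hence [G_4] and [G_6] determine all [G_w]; these are the power sums of the numbers
    [1/lambda^2], so they determine the lattice, and [(G_4^3 : G_6^2)] separates the
    points of the fundamental domain.

    A form of weight [12 n + 4 a + 6 b] is [G_4^a G_6^b] times a binary form of degree [n]
    in [(G_4^3, G_6^2)].  So once it has [n] distinct zeros in the interior of the arc, its
    only other zeros in the fundamental domain can be [rho] (where [G_4 = 0]) and [i]
    (where [G_6 = 0]), both on the arc.  This replaces the valence formula.

    On the arc, [e^(i k t / 2) E_k(e^(i t)) = 2 cos(k t / 2) + (2 + 2 cos t)^(-k/2) + (small)],
    and the signs of the form at suitable sample points give the [n] zeros. *)

Require Import Defs.
From mathcomp Require Import all_boot all_order all_algebra.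
From mathcomp Require Import complex.
From mathcomp Require Import all_classical all_reals all_analysis.
From mathcomp Require Import ring lra zify.
Set Implicit Arguments.
Unset Strict Implicit.
Unset Printing Implicit Defensive.
Import Order.TTheory GRing.Theory Num.Theory.
Import numFieldNormedType.Exports.
Local Open Scope classical_set_scope.
Local Open Scope ring_scope.
Local Open Scope complex_scope.
Local Notation Re := complex.Re.
Local Notation Im := complex.Im.

(** * Unordered complex sums *)

Section ComplexModulus.
Variable R : realType.
Implicit Types x y z : R[i].

(** Write [k = 2 h] and let [e] be 2 or 3. At the angles [m pi / (e h)] the leading cosine term of
    [E_(e k)] is [2 (-1)^m], and the difficulty is to keep [E_k^e] from spoiling this sign. For even
    [m] there is ample room. For odd [m] the leading term [2 cos(h t)] of [E_k] is 0 ([e = 2]) or at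
    most 1 ([e = 3]), and the danger is the term [(2 + 2 cos t)^(-h)], which rises to 1 at [rho].
    Parity helps: an odd [m] never gives [rho] itself, so the angle stays below [2 pi / 3] by at
    least [pi / (6 h)], respectively [pi / (3 h)]. This bounds the term by 50/91, respectively
    43/200, for all [h] in range. The cubic case is tight (1.99875 against 2), whence the care with
    constants.

    Two proportional lattices are compared through shortest vectors. In a reduced lattice these have
    length 1, so comparing in both directions forces a scaling of modulus 1; then the imaginary
    parts agree, and finally the points. *)

Definition cabs z : R := Normc.normc z.

Lemma normr_cabs z : `|z| = (cabs z)%:C.
Proof. by case: z. Qed.

Lemma cabs_ge0 z : 0 <= cabs z.
Proof. by rewrite -lecR -normr_cabs normr_ge0. Qed.

Lemma cabs0 : cabs 0 = 0.
Proof. exact: Normc.normc0. Qed.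

Lemma cabs1 : cabs 1 = 1.
Proof. exact: Normc.normc1. Qed.

Lemma cabsM x y : cabs (x * y) = cabs x * cabs y.
Proof. exact: Normc.normcM. Qed.

Lemma cabsV x : cabs x^-1 = (cabs x)^-1.
Proof. exact: Normc.normcV. Qed.

Lemma cabsX x n : cabs (x ^+ n) = cabs x ^+ n.
Proof. by elim: n => [|n IH]; rewrite ?cabs1 // !exprS cabsM IH. Qed.

Lemma cabsD x y : cabs (x + y) <= cabs x + cabs y.
Proof. exact: (@le_normcD R x y). Qed.

Lemma cabsN x : cabs (- x) = cabs x.
Proof. exact: (@normcN R x). Qed.

Lemma cabsB x y : cabs (x - y) <= cabs x + cabs y.
Proof. by rewrite -(cabsN y) cabsD. Qed.

Lemma cabs_eq0 x : (cabs x == 0) = (x == 0).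
Proof.
apply/eqP/eqP => [/Normc.eq0_normc //|->]; exact: cabs0.
Qed.

Lemma cabs_gt0 x : (0 < cabs x) = (x != 0).
Proof. by rewrite lt_neqAle eq_sym cabs_eq0 cabs_ge0 andbT. Qed.

Lemma cabs_sqr z : cabs z ^+ 2 = Re z ^+ 2 + Im z ^+ 2.
Proof. by case: z => a b; rewrite sqr_sqrtr ?addr_ge0 ?sqr_ge0. Qed.

Lemma cabs_real (a : R) : cabs a%:C = `|a|.
Proof. by rewrite /cabs /= expr0n addr0 sqrtr_sqr. Qed.

Lemma ge_cabs_Re z : `|Re z| <= cabs z.
Proof. by rewrite -lecR -normr_cabs normc_ge_Re. Qed.

Lemma ge_cabs_Im z : `|Im z| <= cabs z.
Proof.
rewrite -(@ler_pXn2r _ 2) ?nnegrE ?cabs_ge0 // cabs_sqr -normrX.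
by rewrite ger0_norm ?sqr_ge0 // lerDr sqr_ge0.
Qed.

Lemma cabs_sum I (s : seq I) (F : I -> R[i]) :
  cabs (\sum_(i <- s) F i) <= \sum_(i <- s) cabs (F i).
Proof.
elim: s => [|i s IH]; first by rewrite !big_nil cabs0.
by rewrite !big_cons (le_trans (cabsD _ _)) // lerD2l.
Qed.

End ComplexModulus.

Section FiniteSums.
Variables (R : realType) (I : choiceType).

Lemma ler_sum_sub (F : I -> R) (s t : seq I) : (forall i, 0 <= F i) ->
  uniq s -> {subset s <= t} -> \sum_(i <- s) F i <= \sum_(i <- t) F i.
Proof.
move=> F0; elim: s t => [|i s IH] t /=.
  by rewrite big_nil sumr_ge0.
move=> /andP[iNs us] st; rewrite big_cons.
have it : i \in t by apply: st; rewrite inE eqxx.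
rewrite (perm_big _ (perm_to_rem it)) big_cons lerD2l; apply: IH => // j js.
have := st j; rewrite inE js orbT => /(_ isT) jt.
have := perm_mem (perm_to_rem it) j; rewrite jt inE => /esym/orP[/eqP ji|//].
by rewrite -ji js in iNs.
Qed.

End FiniteSums.

Section Sums.
Variable R : realType.
Local Notation C := R[i].

(** Finite index sets are duplicate-free lists, so that estimates are made on big operators over
    sequences; [summability_sumE] links this to the limit in [eisenstein]. *)
Definition has_sum (I : choiceType) (f : I -> C) (l : C) :=
  forall e : R, 0 < e -> exists A : seq I, forall s, uniq s ->
    {subset A <= s} -> cabs (\sum_(i <- s) f i - l) < e.

Definition abs_le (I : choiceType) (f : I -> C) (M : R) :=
  forall s, uniq s -> \sum_(i <- s) cabs (f i) <= M.

Section OneIndex.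
Variable I : choiceType.
Implicit Types (f g : I -> C) (l : C).

Lemma has_sum_near f l e : has_sum f l -> 0 < e -> forall B : seq I,
  exists s, [/\ uniq s, {subset B <= s} & cabs (\sum_(i <- s) f i - l) < e].
Proof.
move=> fl e0 B; have [A H] := fl e e0.
exists (undup (A ++ B)); split; first exact: undup_uniq.
  by move=> x xB; rewrite mem_undup mem_cat xB orbT.
apply: H; first exact: undup_uniq.
by move=> x xA; rewrite mem_undup mem_cat xA.
Qed.

Lemma has_sum_unique f l l' : has_sum f l -> has_sum f l' -> l = l'.
Proof.
move=> fl fl'; apply/eqP; rewrite -subr_eq0 -cabs_eq0.
rewrite eq_le cabs_ge0 andbT; apply/ler_addgt0Pl => e e0; rewrite addr0.
have e2 : 0 < e / 2 by rewrite divr_gt0.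
have [A HA] := fl _ e2.
have [s [us As H]] := has_sum_near fl' e2 A.
have -> : l - l' = (\sum_(i <- s) f i - l') - (\sum_(i <- s) f i - l) by ring.
rewrite (le_trans (cabsB _ _)) // [e]splitr ltW // ltrD //; exact: HA.
Qed.

Lemma eq_has_sum f g l : f =1 g -> has_sum f l -> has_sum g l.
Proof. by move=> /funext ->. Qed.

Lemma has_sumD f g l l' :
  has_sum f l -> has_sum g l' -> has_sum (fun i => f i + g i) (l + l').
Proof.
move=> fl gl e e0; have e2 : 0 < e / 2 by rewrite divr_gt0.
have [A HA] := fl _ e2; have [B HB] := gl _ e2.
exists (A ++ B) => s us ABs; rewrite big_split /= opprD addrACA.
rewrite (le_lt_trans (cabsD _ _)) // [e]splitr ltrD //.
  by apply: HA => // x xA; apply: ABs; rewrite mem_cat xA.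
by apply: HB => // x xA; apply: ABs; rewrite mem_cat xA orbT.
Qed.

Lemma has_sumZ (c : C) f l :
  has_sum f l -> has_sum (fun i => c * f i) (c * l).
Proof.
move=> fl e e0.
have c0 : 0 < cabs c + 1 by rewrite ltr_wpDl ?cabs_ge0.
have [A HA] := fl _ (divr_gt0 e0 c0); exists A => s us As.
rewrite -big_distrr -mulrBr cabsM.
have := HA s us As; rewrite ltr_pdivlMr // mulrC; apply: le_lt_trans.
by rewrite ler_wpM2r ?cabs_ge0 // lerDl.
Qed.

Lemma has_sumN f l : has_sum f l -> has_sum (fun i => - f i) (- l).
Proof.
move=> /(has_sumZ (-1)); rewrite mulN1r; apply: eq_has_sum => i.
by rewrite mulN1r.
Qed.

Lemma has_sumB f g l l' :
  has_sum f l -> has_sum g l' -> has_sum (fun i => f i - g i) (l - l').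
Proof. by move=> fl /has_sumN; apply: has_sumD. Qed.

Lemma has_sum_finite f (A : seq I) : uniq A ->
  (forall i, i \notin A -> f i = 0) -> has_sum f (\sum_(i <- A) f i).
Proof.
move=> uA f0 e e0; exists A => s us As.
rewrite (bigID (mem A)) /= [X in _ + X - _]big1 ?addr0; last exact: f0.
rewrite -big_filter (@perm_big _ _ _ _ _ A) ?subrr ?cabs0 //.
apply: uniq_perm => //; first exact: filter_uniq.
by move=> x; rewrite mem_filter; case: (boolP (x \in A)) => // /As ->.
Qed.

Lemma has_sum0 : has_sum (fun _ : I => 0) 0.
Proof. by have := @has_sum_finite (fun _ => 0) [::]; rewrite big_nil; apply. Qed.

Lemma abs_le_ge0 f M : abs_le f M -> 0 <= M.
Proof. by move=> /(_ [::] isT); rewrite big_nil. Qed.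

Lemma abs_le_dom f g M : abs_le g M ->
  (forall i, cabs (f i) <= cabs (g i)) -> abs_le f M.
Proof. by move=> H fg s us; rewrite (le_trans _ (H s us)) // ler_sum. Qed.

Lemma abs_leD f g M N :
  abs_le f M -> abs_le g N -> abs_le (fun i => f i + g i) (M + N).
Proof.
move=> fM gN s us; rewrite (le_trans _ (lerD (fM s us) (gN s us))) //.
by rewrite -big_split ler_sum // => i _; rewrite cabsD.
Qed.

Lemma abs_leZ (c : C) f M : abs_le f M -> abs_le (fun i => c * f i) (cabs c * M).
Proof.
move=> fM s us; under eq_bigr do rewrite cabsM.
by rewrite -big_distrr ler_wpM2l ?cabs_ge0 ?fM.
Qed.

Lemma has_sum_le f M l : abs_le f M -> has_sum f l -> cabs l <= M.
Proof.
move=> fM fl; apply/ler_addgt0Pl => e e0.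
have [s [us _ H]] := has_sum_near fl e0 [::].
have -> : l = \sum_(i <- s) f i - (\sum_(i <- s) f i - l) by ring.
rewrite (le_trans (cabsB _ _)) // addrC lerD //; first exact: ltW.
by rewrite (le_trans (cabs_sum _ _)) ?fM.
Qed.

Lemma has_sum_nonneg (g : I -> R) M : (forall i, 0 <= g i) ->
  abs_le (fun i => (g i)%:C) M -> exists l : R, has_sum (fun i => (g i)%:C) l%:C.
Proof.
move=> g0 gM; pose E : set R := [set r | exists2 s : seq I, uniq s & r = \sum_(i <- s) g i].
have supE : has_sup E.
  split; first by exists 0, [::] => //; rewrite big_nil.
  exists M => _ [s us ->]; rewrite (le_trans _ (gM s us)) // ler_sum // => i _.
  by rewrite cabs_real ger0_norm.
exists (sup E) => e e0; have [_ [A uA ->] HA] := sup_adherent e0 supE.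
exists A => s us As; rewrite -rmorph_sum -rmorphB cabs_real distrC ger0_norm.
  rewrite ltrBlDr -ltrBlDl (lt_le_trans HA) // ler_sum_sub //.
by rewrite subr_ge0 ub_le_sup //; [case: supE | exists s].
Qed.

Lemma has_sum_exists f M : abs_le f M -> exists l, has_sum f l.
Proof.
move=> fM.
have real_case (u : I -> R) : (forall i, `|u i| <= cabs (f i)) ->
    exists l : R, has_sum (fun i => (u i)%:C) l%:C.
  (* A real family dominated by a summable [a] is the difference of the nonnegative families [a + u]
     and [a]. *)
  move=> uf; pose a i := cabs (f i).
  have [l1 H1] : exists l : R, has_sum (fun i => (a i)%:C) l%:C.
    apply: (@has_sum_nonneg _ M) => [i|]; first exact: cabs_ge0.
    apply: abs_le_dom fM _ => i.
    by rewrite cabs_real ger0_norm ?cabs_ge0.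
  have [l2 H2] : exists l : R, has_sum (fun i => (a i + u i)%:C) l%:C.
    apply: (@has_sum_nonneg _ (M + M)) => [i|].
      by have := uf i; rewrite ler_norml /a => /andP[? _]; lra.
    apply: abs_le_dom (abs_leD fM fM) _ => i.
    have -> : cabs (f i + f i) = a i + a i.
      rewrite -mulr2n -mulr_natl cabsM -(rmorph_nat (real_complex R)) cabs_real.
      by rewrite ger0_norm // mulr_natl mulr2n.
    rewrite cabs_real (le_trans (ler_normD _ _)) // lerD //.
    by rewrite ger0_norm ?cabs_ge0.
  exists (l2 - l1); rewrite rmorphB; apply: eq_has_sum (has_sumB H2 H1) => i.
  by rewrite -rmorphB addrAC subrr add0r.
have [l1 H1] := real_case (fun i => Re (f i)) (fun i => ge_cabs_Re _).
have [l2 H2] := real_case (fun i => Im (f i)) (fun i => ge_cabs_Im _).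
exists (l1%:C + 'i%C * l2%:C); apply: eq_has_sum (has_sumD H1 (has_sumZ 'i%C H2)) => i.
by rewrite -complexE.
Qed.

(** A total operation, with value 0 for families without a sum, so that [tsum_perm] is an
    unconditional identity. *)
Definition tsum f : C := xget 0 [set l | has_sum f l].

Lemma has_sum_tsum f M : abs_le f M -> has_sum f (tsum f).
Proof.
by move=> /has_sum_exists[l fl]; rewrite /tsum; case: xgetP => // /(_ l).
Qed.

Lemma tsumE f l : has_sum f l -> tsum f = l.
Proof.
rewrite /tsum; case: xgetP => [l' _ /= H /(has_sum_unique H) //|/(_ l) /= H /H //].
Qed.

End OneIndex.
End Sums.

(** * Reindexing, iterated sums and products of unordered sums *)

Section Reindexing.
Variable R : realType.
Local Notation C := R[i].

(** The map has to reach only the support of [f]. Sums over coprime pairs, over their multiples, or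
    over the pairs [(p, - p)] thus become sums over a larger index type. *)
Lemma has_sum_reindex (I J : choiceType) (h : I -> J) (f : J -> C) l :
  injective h -> (forall j, f j != 0 -> exists i, h i = j) ->
  has_sum (f \o h) l -> has_sum f l.
Proof.
move=> hI hf fl e e0; have [A HA] := fl e e0.
pose k j := if pselect (exists i, h i = j) is left H then Some (sval (cid H)) else None.
have hk : ocancel k h.
  by move=> j; rewrite /k; case: pselect => //= H; exact: svalP (cid H).
have kh i : k (h i) = Some i.
  rewrite /k; case: pselect => [H|[]]; last by exists i.
  by congr Some; apply: hI; exact: svalP (cid H).
exists (map h A) => s us As.
have -> : \sum_(j <- s) f j = \sum_(i <- pmap k s) (f \o h) i.
  elim: s {us As} => [|j s IH]; first by rewrite !big_nil.
  rewrite big_cons IH /=; case E : (k j) => [i|] /=.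
    by rewrite big_cons /=; have := hk j; rewrite E /= => ->.
  have [->|/hf[i ji]] := eqVneq (f j) 0; first by rewrite add0r.
  by move: E; rewrite -ji kh.
apply: HA.
  apply: (pmap_uniq (g := h)) => // j.
move=> i iA; rewrite mem_pmap; apply/mapP; exists (h i); last by rewrite kh.
by apply: As; apply: map_f.
Qed.

Lemma abs_le_comp (I J : choiceType) (h : I -> J) (f : J -> C) M :
  injective h -> abs_le f M -> abs_le (f \o h) M.
Proof.
move=> hI fM s us; have := fM (map h s); rewrite big_map; apply.
by rewrite map_inj_uniq.
Qed.

Lemma has_sum_perm (I : choiceType) (h g : I -> I) (f : I -> C) l :
  cancel h g -> cancel g h -> has_sum f l -> has_sum (f \o h) l.
Proof.
move=> hg gh fl; apply: (has_sum_reindex (h := g)) (can_inj gh) _ _.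
  by move=> j _; exists (h j); rewrite hg.
by apply: eq_has_sum fl => i /=; rewrite gh.
Qed.

Lemma tsum_perm (I : choiceType) (h g : I -> I) (f : I -> C) :
  cancel h g -> cancel g h -> tsum (f \o h) = tsum f.
Proof.
move=> hg gh; rewrite /tsum; congr xget; apply/seteqP; split => l /= H.
  have := has_sum_perm gh hg H; apply: eq_has_sum => i /=; by rewrite gh.
exact: has_sum_perm H.
Qed.

(** A finite set [s] of rows is approximated by one finite set [t] of columns, with error below
    [e / 2 / (size s + 1)] in each row, hence at most [e / 2] in total. *)
Lemma has_sum_sigma (I J : choiceType) (F : I * J -> C) (g : I -> C) L :
  (forall i, has_sum (fun j => F (i, j)) (g i)) -> has_sum F L -> has_sum g L.
Proof.
move=> Fg FL e e0; have e2 : 0 < e / 2 by rewrite divr_gt0.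
have [A HA] := FL _ e2; exists (undup (map fst A)) => s us As.
pose d := e / 2 / (size s).+1%:R.
have d0 : 0 < d by rewrite divr_gt0.
have [t [ut At Ht]] : exists t : seq J, [/\ uniq t, {subset map snd A <= t} &
    forall i, i \in s -> cabs (\sum_(j <- t) F (i, j) - g i) < d].
  have [t Ht] : exists t : seq J, forall i, i \in s -> forall t', uniq t' ->
      {subset t <= t'} -> cabs (\sum_(j <- t') F (i, j) - g i) < d.
    elim: (s) => [|i s' [t IH]]; first by exists [::].
    have [t1 H1] := Fg i _ d0; exists (t1 ++ t) => i' .
    rewrite inE => /orP[/eqP ->|/IH H] t' ut' tt'.
      by apply: H1 => // x xt; apply: tt'; rewrite mem_cat xt.
    by apply: H => // x xt; apply: tt'; rewrite mem_cat xt orbT.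
  exists (undup (map snd A ++ t)); split; first exact: undup_uniq.
    by move=> x xA; rewrite mem_undup mem_cat xA.
  move=> i /Ht; apply; first exact: undup_uniq.
  by move=> x xt; rewrite mem_undup mem_cat xt orbT.
have Hst : cabs (\sum_(i <- s) \sum_(j <- t) F (i, j) - L) < e / 2.
  rewrite -(big_allpairs_dep (h := pair)) /=; apply: HA.
    by rewrite allpairs_uniq // => -[? ?] [? ?] _ _ [-> ->].
  move=> [i j] ijA; apply/allpairsP; exists (i, j); split => //=.
    by apply: As; rewrite mem_undup; apply/mapP; exists (i, j).
  by apply: At; apply/mapP; exists (i, j).
have Hd : cabs (\sum_(i <- s) \sum_(j <- t) F (i, j) - \sum_(i <- s) g i) <= e / 2.
  rewrite -sumrB (le_trans (cabs_sum _ _)) //.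
  apply: (@le_trans _ _ (\sum_(i <- s) d)).
    by rewrite big_seq [leRHS]big_seq ler_sum // => i /Ht /ltW.
  rewrite big_const_seq count_predT iter_addr addr0 -[d *+ _]mulr_natr /d -mulrA.
  by rewrite ler_piMr ?ltW // mulrC ltr_pdivrMr // mul1r ltr_nat.
rewrite [e]splitr.
have -> : \sum_(i <- s) g i - L = (\sum_(i <- s) \sum_(j <- t) F (i, j) - L)
   - (\sum_(i <- s) \sum_(j <- t) F (i, j) - \sum_(i <- s) g i) by ring.
by rewrite (le_lt_trans (cabsB _ _)) // ltr_leD.
Qed.

Lemma ler_sum_prod (I J : choiceType) (F : I * J -> R) a b M N :
  (forall i, 0 <= a i) -> (forall j, 0 <= b j) ->
  (forall i j, F (i, j) <= a i * b j) ->
  (forall s, uniq s -> \sum_(i <- s) a i <= M) ->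
  (forall t, uniq t -> \sum_(j <- t) b j <= N) ->
  forall s, uniq s -> \sum_(p <- s) F p <= M * N.
Proof.
move=> a0 b0 Fab aM bN s us.
apply: (@le_trans _ _ (\sum_(p <- s) a p.1 * b p.2)).
  by apply: ler_sum => -[i j] _.
pose u := undup (map fst s); pose v := undup (map snd s).
apply: (@le_trans _ _ (\sum_(p <- [seq (i, j) | i <- u, j <- v]) a p.1 * b p.2)).
  apply: ler_sum_sub => //.
    by move=> p; rewrite mulr_ge0.
  move=> [i j] ijs; apply/allpairsP; exists (i, j); rewrite !mem_undup.
  by split => //; apply/mapP; exists (i, j).
rewrite (big_allpairs_dep (h := pair)) /=.
under eq_bigr do rewrite -big_distrr /=.
rewrite -big_distrl /= ler_pM ?sumr_ge0 //.
  by rewrite aM ?undup_uniq.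
by rewrite bN ?undup_uniq.
Qed.

Lemma abs_leM (I J : choiceType) (f : I -> C) (g : J -> C) M N :
  abs_le f M -> abs_le g N -> abs_le (fun p : I * J => f p.1 * g p.2) (M * N).
Proof.
move=> fM gN; rewrite /abs_le.
apply: (ler_sum_prod (F := fun p => cabs (f p.1 * g p.2)) (a := fun i => cabs (f i)) (b := fun j => cabs (g j))) => //=.
- by move=> i; exact: cabs_ge0.
- by move=> i; exact: cabs_ge0.
- by move=> i j; rewrite cabsM.
Qed.

Lemma has_sumM (I J : choiceType) (f : I -> C) (g : J -> C) M N l l' :
  abs_le f M -> abs_le g N -> has_sum f l -> has_sum g l' ->
  has_sum (fun p : I * J => f p.1 * g p.2) (l * l').
Proof.
move=> fM gN fl gl; have [L HL] := has_sum_exists (abs_leM fM gN).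
have H : has_sum (fun i => f i * l') L.
  by apply: has_sum_sigma HL => i /=; exact: has_sumZ.
have -> // : l * l' = L.
have := has_sumZ l' fl; rewrite mulrC => H'; apply: has_sum_unique H' _.
by apply: eq_has_sum H => i; rewrite mulrC.
Qed.

Lemma summability_sumE (I : choiceType) (f : I -> C) l :
  has_sum f l -> summability.sum (R := R[i]^o) f = l.
Proof.
move=> fl; have PF := @summability.totally_filter I; have FF := @filter_filter _ _ PF.
apply: cvg_lim; first exact: norm_hausdorff.
apply/cvgrPdist_lt => e e0.
have e0' : 0 < Re e by move: e0; rewrite ltcE => /andP[].
have eE : e = (Re e)%:C by rewrite RRe_real ?gtr0_real.
have [A HA] := fl _ e0'.
exists (finmap.seq_fset tt A) => // B AB.
rewrite eE distrC normr_cabs ltcR /summability.partial_sum.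
rewrite -(finmap.big_seq_fsetE _ _ xpredT f) /=.
apply: HA; first exact: finmap.fset_uniq.
by move=> x xA; apply: (finmap.fsubsetP AB); rewrite finmap.seq_fsetE.
Qed.

End Reindexing.

(** * Lattice sums *)

Section IntegerSums.
Variable R : realType.

Lemma sum_nat_le (u : nat -> R) M : (forall n, 0 <= u n) ->
  (forall N, \sum_(0 <= n < N) u n <= M) ->
  forall s, uniq s -> \sum_(n <- s) u n <= M.
Proof.
move=> u0 uM s us; apply: le_trans (uM (\max_(i <- s) i).+1).
apply: ler_sum_sub => // n ns; rewrite mem_index_iota /= ltnS.
exact: leq_bigmax_seq.
Qed.

Lemma sum_int_le (u : nat -> R) M : (forall n, 0 <= u n) ->
  (forall s, uniq s -> \sum_(n <- s) u n <= M) ->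
  forall s : seq int, uniq s -> \sum_(n <- s) u `|n|%N <= M + M.
Proof.
move=> u0 uM s us; rewrite (bigID (fun n : int => 0 <= n)) /= lerD //.
  rewrite -big_filter -(big_map absz xpredT u) uM //.
  rewrite map_inj_in_uniq ?filter_uniq // => x y.
  by rewrite !mem_filter => /andP[? _] /andP[? _]; lia.
rewrite -big_filter -(big_map absz xpredT u) uM //.
rewrite map_inj_in_uniq ?filter_uniq // => x y.
by rewrite !mem_filter => /andP[? _] /andP[? _]; lia.
Qed.

(** [1 / sqrt n], with 0 treated as 1. Splitting [|c tau + d|] into a product over [c] and [d]
    leaves each coordinate half of the exponent. *)
Definition root_weight (n : nat) : R := (Num.sqrt (maxn n 1)%:R)^-1.

Lemma root_weight_gt0 n : 0 < root_weight n.
Proof. by rewrite invr_gt0 sqrtr_gt0 ltr0n; lia. Qed.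

Lemma root_weight_le1 n : root_weight n <= 1.
Proof.
rewrite invf_le1 ?sqrtr_gt0 ?ltr0n; last by lia.
rewrite -[leLHS]sqrtr1; apply: ler_wsqrtr.
by rewrite (ler_nat _ 1); lia.
Qed.

Lemma root_weight_sqr n : root_weight n ^+ 2 = (maxn n 1)%:R^-1.
Proof. by rewrite exprVn sqr_sqrtr. Qed.

(** Comparison with the integral of [x^(-3/2)]: consecutive square roots [a < b] satisfy
    [b^-3 <= 2 (1/a - 1/b)], which telescopes. The indices 0 and 1 contribute 1 each. *)
Lemma sum_root_weight3 N : \sum_(0 <= n < N.+2) root_weight n ^+ 3 <=
  4 - 2 * root_weight N.+1.
Proof.
elim: N => [|N IH].
  rewrite !big_nat_recr //= big_nil /root_weight /= sqrtr1 invr1; lra.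
rewrite big_nat_recr //= (le_trans (lerD IH (lexx _))) //.
rewrite /root_weight !(maxn_idPl _) //.
set a := Num.sqrt N.+1%:R; set b := Num.sqrt N.+2%:R.
have a0 : 0 < a by rewrite sqrtr_gt0 ltr0n.
have b0 : 0 < b by rewrite sqrtr_gt0 ltr0n.
have a2 : a ^+ 2 = N.+1%:R by rewrite sqr_sqrtr.
have b2 : b ^+ 2 = N.+2%:R by rewrite sqr_sqrtr.
have ab : a <= b by apply: ler_wsqrtr; rewrite ler_nat.
have e1 : (b - a) * (b + a) = 1.
  by rewrite -subr_sqr a2 b2 -natrB // subSnn.
suff : b^-1 ^+ 3 <= 2 * (a^-1 - b^-1) by lra.
have -> : 2 * (a^-1 - b^-1) = 2 / (a * b * (a + b)).
  have -> : 2 / (a * b * (a + b)) = 2 * ((b - a) * (b + a)) / (a * b * (a + b)).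
    by rewrite e1 mulr1.
  by field; rewrite !gt_eqF // addr_gt0.
rewrite ler_pdivlMr ?mulr_gt0 ?addr_gt0 //.
rewrite exprVn mulrC ler_pdivrMr ?exprn_gt0 //.
by nra.
Qed.

Lemma sum_root_weight w : (3 <= w)%N ->
  forall s, uniq s -> \sum_(n <- s) root_weight n ^+ w <= 4.
Proof.
move=> w3; apply: sum_nat_le => [n|N].
  by rewrite exprn_ge0 // ltW // root_weight_gt0.
apply: (@le_trans _ _ (\sum_(0 <= n < N.+2) root_weight n ^+ 3)).
  rewrite !big_nat_recr //= -addrA ler_wpDr //.
    by rewrite addr_ge0 // exprn_ge0 // ltW // root_weight_gt0.
  apply: ler_sum => n _; apply: ler_wiXn2l => //.
    by rewrite ltW // root_weight_gt0.
  exact: root_weight_le1.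
apply: (le_trans (sum_root_weight3 _)).
by rewrite gerBl mulr_ge0 // ltW // root_weight_gt0.
Qed.

End IntegerSums.

(** * Absolute convergence of the lattice sums *)

Section Lattice.
Variable R : realType.
Local Notation C := R[i].
Implicit Types (tau : C) (p q : int * int).

Definition latt tau p : C := p.1%:~R * tau + p.2%:~R.

Lemma lattD tau p q : latt tau (p + q) = latt tau p + latt tau q.
Proof. by rewrite /latt /= !intrD; ring. Qed.

Lemma lattN tau p : latt tau (- p) = - latt tau p.
Proof. by rewrite /latt /= !mulrNz; ring. Qed.

Lemma latt0 tau : latt tau 0 = 0.
Proof. by rewrite /latt /= mul0r add0r. Qed.

Lemma intrC (n : int) : n%:~R = (n%:~R : R)%:C :> C.
Proof. by rewrite rmorph_int. Qed.

Lemma Re_latt tau p : Re (latt tau p) = p.1%:~R * Re tau + p.2%:~R.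
Proof. by case: tau => x y; rewrite /latt !intrC; simpc. Qed.

Lemma Im_latt tau p : Im (latt tau p) = p.1%:~R * Im tau.
Proof. by case: tau => x y; rewrite /latt !intrC; simpc. Qed.

Lemma latt_eq0 tau p : 0 < Im tau -> (latt tau p == 0) = (p == 0).
Proof.
move=> t0; apply/eqP/eqP => [H|->]; last exact: latt0.
have := Im_latt tau p; rewrite H /= => /esym/eqP.
rewrite mulf_eq0 (gt_eqF t0) orbF intr_eq0 => /eqP p1.
have := Re_latt tau p; rewrite H p1 mul0r add0r /= => /esym/eqP.
by rewrite intr_eq0 => /eqP p2; case: p p1 p2 {H} => a b /= -> ->.
Qed.

(** A lower bound in product form: it dominates the double series of weight [w] by a product of two
    single series of exponent [w / 2], convergent from [w = 3] on. *)
Definition latt_bound tau (K : R) := forall p, p != 0 ->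
  (maxn `|p.1| 1 * maxn `|p.2| 1)%:R <= (K * cabs (latt tau p)) ^+ 2.

Lemma latt_bound_exists tau : 0 < Im tau -> exists2 K, 0 <= K & latt_bound tau K.
Proof.
move=> y0; set y := Im tau in y0 *.
(* The imaginary part gives [|c| <= |c tau + d| / y], and then [|d| <= (1 + |tau| / y) |c tau + d|];
   [K] exceeds both factors. *)
pose K := y^-1 + 1 + cabs tau / y.
have K0 : 0 <= K by rewrite !addr_ge0 ?divr_ge0 ?cabs_ge0 // ltW ?invr_gt0.
exists K => // p p0; rewrite expr2 natrM.
have L0 : 0 <= cabs (latt tau p) by exact: cabs_ge0.
have c1 : `|p.1|%:R <= y^-1 * cabs (latt tau p).
  rewrite mulrC ler_pdivlMr // -[y in leLHS](gtr0_norm y0).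
  by rewrite natr_absz intr_norm -normrM -Im_latt ge_cabs_Im.
have cT : 0 <= cabs tau / y by rewrite divr_ge0 ?cabs_ge0 // ltW.
have y1 : 0 <= y^-1 by rewrite invr_ge0 ltW.
have c2 : `|p.2|%:R <= (1 + cabs tau / y) * cabs (latt tau p).
  have -> : `|p.2|%:R = cabs (p.2%:~R : C).
    by rewrite intrC cabs_real natr_absz intr_norm.
  have -> : p.2%:~R = latt tau p - p.1%:~R * tau by rewrite /latt; ring.
  rewrite (le_trans (cabsB _ _)) // mulrDl mul1r lerD2l cabsM intrC cabs_real.
  rewrite mulrC -mulrA ler_wpM2l ?cabs_ge0 // -intr_norm -natr_absz.
  exact: c1.
have one : 1 <= K * cabs (latt tau p).
  have [p10|p10] := eqVneq p.1 0.
    have p20 : p.2 != 0 by apply: contraNneq p0 => p20; case: p p10 p20 {L0 c1 c2} => a b /= -> ->.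
    have : 1 <= `|p.2|%:R :> R by rewrite (ler_nat _ 1); lia.
    move=> /le_trans/(_ c2)/le_trans; apply; apply: ler_wpM2r => //.
    by rewrite /K; lra.
  have : 1 <= `|p.1|%:R :> R by rewrite (ler_nat _ 1); lia.
  move=> /le_trans/(_ c1)/le_trans; apply; apply: ler_wpM2r => //.
  by rewrite /K; lra.
have mx n r : `|n|%:R <= r * cabs (latt tau p) -> r <= K ->
    (maxn `|n| 1)%:R <= K * cabs (latt tau p).
  move=> H rK; rewrite maxnE; case: (leqP `|n| 1) => h.
    by rewrite subnKC.
  by rewrite (eqP (ltnW h : 1 - _ == 0)%N) addn0 (le_trans H) // ler_wpM2r.
apply: ler_pM => //; first by apply: mx c1 _; rewrite /K; lra.
by apply: mx c2 _; rewrite /K; lra.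
Qed.

Lemma latt_term_le tau K w p : (0 < w)%N -> 0 <= K -> latt_bound tau K ->
  cabs (latt tau p ^- w) <= K ^+ w * (root_weight R `|p.1| ^+ w * root_weight R `|p.2| ^+ w).
Proof.
move=> w0 K0 H; have rw n := ltW (root_weight_gt0 R n).
rewrite -exprVn cabsX cabsV -!exprMn; apply: lerXn2r; rewrite ?nnegrE.
- by rewrite invr_ge0 cabs_ge0.
- by rewrite !mulr_ge0.
(* The zero lattice point contributes [0^-1 = 0], which is why the lattice sums can run over all
   pairs. *)
have [->|p0] := eqVneq p 0.
  by rewrite latt0 cabs0 invr0 !mulr_ge0.
have /= Hp := H p p0.
have [L0|L0] := eqVneq (cabs (latt tau p)) 0.
  by rewrite L0 invr0 !mulr_ge0.
have {}L0 : 0 < cabs (latt tau p) by rewrite lt_neqAle eq_sym L0 cabs_ge0.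
rewrite -(@ler_pXn2r _ 2) ?nnegrE ?invr_ge0 ?mulr_ge0 ?cabs_ge0 //.
rewrite !exprMn !root_weight_sqr exprVn -invfM -natrM.
rewrite ler_pdivlMr ?ltr0n; last by lia.
by rewrite mulrC ler_pdivrMr ?exprn_gt0 // -exprMn.
Qed.

Lemma latt_sum_exponent tau K w : (3 <= w)%N -> 0 <= K -> latt_bound tau K ->
  abs_le (fun p => latt tau p ^- w) (K ^+ w * 64).
Proof.
move=> w3 K0 H s us.
apply: (@le_trans _ _ (\sum_(p <- s) K ^+ w *
   (root_weight R `|p.1| ^+ w * root_weight R `|p.2| ^+ w))).
  by apply: ler_sum => p _; apply: latt_term_le => //; lia.
rewrite -big_distrr /= ler_wpM2l ?exprn_ge0 //.
have rw n : 0 <= root_weight R n ^+ w by rewrite exprn_ge0 // ltW // root_weight_gt0.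
have -> : 64 = (4 + 4) * (4 + 4) :> R by lra.
apply: (ler_sum_prod (F := fun p => root_weight R `|p.1| ^+ w * root_weight R `|p.2| ^+ w)
  (a := fun n : int => root_weight R `|n| ^+ w) (b := fun n : int => root_weight R `|n| ^+ w)) => //.
- by apply: (sum_int_le (u := fun n => root_weight R n ^+ w)) => // t ut; exact: sum_root_weight.
- by apply: (sum_int_le (u := fun n => root_weight R n ^+ w)) => // t ut; exact: sum_root_weight.
Qed.

Lemma latt_abs_le tau w : 0 < Im tau -> (3 <= w)%N ->
  exists M, abs_le (fun p => latt tau p ^- w) M.
Proof.
move=> t0 w3; have [K K0 H] := latt_bound_exists t0.
by exists (K ^+ w * 64); exact: latt_sum_exponent.
Qed.

Definition gsum tau w : C := tsum (fun p => latt tau p ^- w).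

Lemma has_gsum tau w : 0 < Im tau -> (3 <= w)%N ->
  has_sum (fun p => latt tau p ^- w) (gsum tau w).
Proof. by move=> t0 w3; have [M /has_sum_tsum] := latt_abs_le t0 w3. Qed.

Lemma gsum_odd tau w : 0 < Im tau -> (3 <= w)%N -> odd w -> gsum tau w = 0.
Proof.
move=> t0 w3 ow; have H := has_gsum t0 w3.
have := has_sum_perm (@opprK _) (@opprK _) H => H1.
have /(has_sum_unique H1) : has_sum ((fun p => latt tau p ^- w) \o -%R) (- gsum tau w).
  apply: eq_has_sum (has_sumN H) => p /=.
  by rewrite lattN exprNn -signr_odd ow expr1 mulN1r invrN.
move=> E; have : gsum tau w *+ 2 == 0 by rewrite mulr2n {1}E addNr.
by rewrite mulrn_eq0 /= => /eqP.
Qed.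

End Lattice.

(** * The recursion for lattice sums *)

Section Recursion.
Variable R : realType.
Local Notation C := R[i].

(* [- (-1)^n q(n+1) t_n + ...] is a discrete primitive of [(-1)^n q(n) D_n]
   because the second difference of [q n = (n-1)(w-1-n)] is constant. *)
Lemma alternating_telescope (w : nat) (D t s r : nat -> C) : (8 <= w)%N ->
  (forall n, (2 <= n)%N -> (n + 4 <= w)%N -> t n.+1 + t n = - D n.+1) ->
  (forall n, (1 <= n)%N -> (n + 4 <= w)%N -> s n.+1 + s n = - t n.+1) ->
  (forall n, (1 <= n)%N -> (n + 5 <= w)%N -> r n.+1 + r n = - s n.+1) ->
  forall n, (2 <= n)%N -> (n + 4 <= w)%N ->
  let phi n := (-1) ^+ n * (2 * r n - n%:R * (w%:R - 2 - n%:R) * t n +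
                      (2 * n%:R + 3 - w%:R) * s n) in
  \sum_(3 <= i < n.+1) (-1) ^+ i * (i%:R - 1) * (w%:R - 1 - i%:R) * D i =
  phi n - phi 2%N.
Proof.
move=> w8 Ht Hs Hr n n2 nw phi; elim: n n2 nw => // n IH n2 nw.
have [->|n2'] := eqVneq n 1%N; first by rewrite big_geq // subrr.
rewrite big_nat_recr /=; last by lia.
rewrite IH; [|lia|lia].
have -> : D n.+1 = - (t n.+1 + t n) by rewrite Ht ?opprK //; lia.
have -> : phi n.+1 - phi 2%N = (phi n.+1 - phi n) + (phi n - phi 2%N) by ring.
rewrite [LHS]addrC; congr (_ + _); rewrite /phi exprS -natr1.
have -> : t n.+1 = - (s n.+1 + s n) by rewrite Hs ?opprK //; lia.
have e : s n.+1 = - (r n.+1 + r n) by rewrite Hr ?opprK //; lia.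
rewrite e; ring.
Qed.

(** In the application [D], [t], [s], [r] are triple sums with third exponent 0, 1, 2, 3. The
    equations between their end values express the symmetry of the triple sums and collapse the
    boundary terms to a multiple of [D 3]. *)
Lemma symmetric_telescope (w : nat) (D t s r : nat -> C) : (8 <= w)%N -> ~~ odd w ->
  (forall n, (2 <= n)%N -> (n + 4 <= w)%N -> t n.+1 + t n = - D n.+1) ->
  (forall n, (1 <= n)%N -> (n + 4 <= w)%N -> s n.+1 + s n = - t n.+1) ->
  (forall n, (1 <= n)%N -> (n + 5 <= w)%N -> r n.+1 + r n = - s n.+1) ->
  s 1%N = t 2%N -> r 1%N = t 3%N -> r 2%N = s 3%N ->
  t (w - 4)%N = t 3%N -> s (w - 4)%N = s 2%N -> r (w - 4)%N = t 3%N ->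
  D (w - 3)%N = D 3%N ->
  \sum_(3 <= i < w - 2) (-1) ^+ i * (i%:R - 1) * (w%:R - 1 - i%:R) * D i =
  - 4 * D 3%N.
Proof.
move=> w8 ew Ht Hs Hr s1 r1 r2 tw sw rw Dw.
have -> : (w - 2 = (w - 4).+2)%N by lia.
rewrite big_nat_recr /=; last by lia.
rewrite (alternating_telescope w8 Ht Hs Hr); [|lia|lia].
have -> : ((w - 4).+1 = w - 3)%N by lia.
rewrite Dw tw sw rw !natrB; [|lia|lia].
have -> : (-1) ^+ (w - 4) = 1 :> C.
  by rewrite -signr_odd oddB ?(negbTE ew) //; lia.
have -> : (-1) ^+ (w - 3) = -1 :> C.
  by rewrite -signr_odd oddB ?(negbTE ew) //; lia.
have s2 : s 2%N = - 2 * t 2%N.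
  have -> : s 2%N = (s 2%N + s 1%N) - s 1%N by ring.
  by rewrite Hs ?s1 //; [ring|lia].
have s3 : s 3%N = - t 3%N - s 2%N by rewrite -Hs //; [ring|lia].
have t3 : t 3%N = - D 3%N - t 2%N by rewrite -Ht //; [ring|lia].
rewrite r2 s3 s2 t3; ring.
Qed.

Definition rec_coef (w i : nat) : R := (i%:R - 1) * (w%:R - 1 - i%:R).

(** The term [i = 3] alone is [2 (w - 4) >= 8]. Hence the factor of [G_w] in the recursion is
    nonzero and [G_w] can be solved for. *)
Lemma rec_coef_sum_gt w : (8 <= w)%N -> 4 < \sum_(3 <= i < w - 2) rec_coef w i.
Proof.
move=> w8; rewrite big_ltn; last by lia.
have h : 4 < rec_coef w 3.
  have : (8%:R : R) <= w%:R by rewrite ler_nat.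
  rewrite /rec_coef; lra.
rewrite ltr_wpDr // big_nat sumr_ge0 // => i /andP[i3 iw].
rewrite /rec_coef mulr_ge0 // ?subr_ge0 ?(ler_nat _ 1); first by lia.
by rewrite lerBrDr natr1 ler_nat; lia.
Qed.

(** * Sums over triples of lattice points with sum zero *)

Variable tau : C.
Hypothesis t0 : 0 < Im tau.

Local Notation I2 := ((int * int) * (int * int))%type.
Implicit Types u : I2.

Definition generic u := [&& u.1 != 0, u.2 != 0 & u.1 + u.2 != 0].
(** The reciprocals of [p], [q] and [r = - (p + q)], all set to 0 as soon as one of the three points
    is 0, so that the partial fraction identity and the symmetries hold for every pair. *)
Definition fstV u : C := if generic u then (latt tau u.1)^-1 else 0.
Definition sndV u : C := if generic u then (latt tau u.2)^-1 else 0.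
Definition thdV u : C := if generic u then - (latt tau (u.1 + u.2))^-1 else 0.
Definition tri a b c u : C := fstV u ^+ a * sndV u ^+ b * thdV u ^+ c.
Definition trisum a b c : C := tsum (tri a b c).

Lemma tri_relation u :
  sndV u * thdV u + fstV u * thdV u + fstV u * sndV u = 0.
Proof.
rewrite /fstV /sndV /thdV; case: ifP => [/and3P[p0 q0 r0]|_]; last by ring.
have {}p0 : latt tau u.1 != 0 by rewrite latt_eq0.
have {}q0 : latt tau u.2 != 0 by rewrite latt_eq0.
have {}r0 : latt tau u.1 + latt tau u.2 != 0 by rewrite -lattD latt_eq0.
by rewrite lattD; field; apply/and3P.
Qed.

(** [swap] and [turn] are two transpositions of the triple [(p, q, - (p + q))]; they generate all
    its permutations. *)
Definition swap u : I2 := (u.2, u.1).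
Definition turn u : I2 := (- (u.1 + u.2), u.2).

Lemma swapK : involutive swap. Proof. by case. Qed.

Lemma turnK : involutive turn.
Proof. by case=> p q; rewrite /turn /=; congr pair; rewrite opprD opprK addrK. Qed.

Lemma generic_swap u : generic (swap u) = generic u.
Proof. by rewrite /generic /= andbCA [u.2 + u.1]addrC. Qed.

Lemma generic_turn u : generic (turn u) = generic u.
Proof.
rewrite /generic /= opprD addrNK !oppr_eq0 -opprD oppr_eq0.
by case: (u.1 + u.2 != 0) (u.2 != 0) (u.1 != 0) => [] [] [].
Qed.

Lemma tri_swap a b c u : tri a b c (swap u) = tri b a c u.
Proof.
rewrite /tri /fstV /sndV /thdV generic_swap; case: ifP => _ /=.
  by rewrite [u.2 + _]addrC; ring.
by ring.
Qed.

Lemma tri_turn a b c u : tri a b c (turn u) = tri c b a u.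
Proof.
rewrite /tri /fstV /sndV /thdV generic_turn; case: ifP => _ /=.
  by rewrite opprD addrNK -opprD !lattN !invrN opprK; ring.
by ring.
Qed.

Lemma trisum_swap a b c : trisum a b c = trisum b a c.
Proof.
rewrite /trisum -(tsum_perm (tri b a c) swapK swapK).
by congr tsum; apply/funext => u /=; rewrite tri_swap.
Qed.

Lemma trisum_turn a b c : trisum a b c = trisum c b a.
Proof.
rewrite /trisum -(tsum_perm (tri c b a) turnK turnK).
by congr tsum; apply/funext => u /=; rewrite tri_turn.
Qed.

Definition summable_tri a b c := exists M, abs_le (tri a b c) M.

Lemma summable_swap a b c : summable_tri a b c -> summable_tri b a c.
Proof.
case=> M H; exists M; have := abs_le_comp (can_inj swapK) H.
by congr (abs_le _ _); apply/funext => u /=; rewrite tri_swap.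
Qed.

Lemma summable_turn a b c : summable_tri a b c -> summable_tri c b a.
Proof.
case=> M H; exists M; have := abs_le_comp (can_inj turnK) H.
by congr (abs_le _ _); apply/funext => u /=; rewrite tri_turn.
Qed.

Lemma triV_bound : exists2 K : R, 1 <= K & forall u,
  [/\ cabs (fstV u) <= K, cabs (sndV u) <= K & cabs (thdV u) <= K].
Proof.
have [K K0 HK] := latt_bound_exists t0.
have H p : cabs (latt tau p)^-1 <= K + 1.
  apply: (le_trans (latt_term_le p (ltn0Sn 0) K0 HK)); rewrite !expr1.
  have := root_weight_le1 R `|p.1|; have := root_weight_le1 R `|p.2|.
  have := root_weight_gt0 R `|p.1|; have := root_weight_gt0 R `|p.2|.
  set a := root_weight _ _; set b := root_weight _ _ => ? ? ? ?.
  have : b * a <= 1 by apply: mulr_ile1 => //; apply: ltW.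
  move=> /(ler_wpM2l K0); rewrite mulr1 => /le_trans; apply; lra.
exists (K + 1); first by lra.
move=> u; rewrite /fstV /sndV /thdV; case: ifP => _.
  by rewrite cabsN.
by rewrite cabs0 !addr_ge0.
Qed.

(** The third factor is bounded, and the other two form a product of absolutely convergent lattice
    sums. *)
Lemma summable_tri33 a b c : (3 <= a)%N -> (3 <= b)%N -> summable_tri a b c.
Proof.
move=> a3 b3; have [K K1 HK] := triV_bound.
have [M HM] := latt_abs_le t0 a3; have [N HN] := latt_abs_le t0 b3.
exists (cabs (K ^+ c)%:C * (M * N)).
apply: abs_le_dom (abs_leZ (K ^+ c)%:C (abs_leM HM HN)) _ => u.
rewrite /tri [leRHS]cabsM cabs_real mulrC !cabsM.
have K0 : 0 <= K by lra.
rewrite ger0_norm ?exprn_ge0 //; apply: ler_pM.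
- exact: cabs_ge0.
- by rewrite mulr_ge0 ?cabs_ge0.
- by rewrite cabsX lerXn2r ?nnegrE ?cabs_ge0 //; case: (HK u).
rewrite /fstV /sndV; case: ifP => _; rewrite ?exprVn //.
by rewrite expr0n gtn_eqF ?(ltn_trans _ a3) // cabs0 mul0r mulr_ge0 ?cabs_ge0.
Qed.

(** Since [x^3 y^2 z <= x^3 (y^3 + z^3)], the exponents [(3, 2, 1)] reduce to [(3, 3, 0)] and
    [(3, 0, 3)]; the excess powers are bounded by powers of [K]. *)
Lemma summable_tri321 a b c : (3 <= a)%N -> (2 <= b)%N -> (1 <= c)%N ->
  summable_tri a b c.
Proof.
move=> a3 b2 c1; have [K K1 HK] := triV_bound.
have [M HM] := @summable_tri33 3 3 0 isT isT.
have [N HN] := summable_turn (summable_swap (@summable_tri33 3 3 0 isT isT)).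
have [N' HN'] := summable_swap (ex_intro (fun M => abs_le _ M) N HN).
have K0 : 0 <= K by lra.
pose e := (a - 3 + (b - 2) + (c - 1))%N.
exists (K ^+ e * (M + N')) => s us.
apply: (@le_trans _ _ (K ^+ e * (\sum_(u <- s) cabs (tri 3 3 0 u)
   + \sum_(u <- s) cabs (tri 3 0 3 u)))); last first.
  by rewrite ler_wpM2l ?exprn_ge0 // lerD ?HM ?HN'.
rewrite -big_split big_distrr /=; apply: ler_sum => u _.
rewrite /tri !cabsM !cabsX !expr0 !mulr1.
have [] := HK u.
have := cabs_ge0 (fstV u); have := cabs_ge0 (sndV u); have := cabs_ge0 (thdV u).
set x := cabs (fstV u); set y := cabs (sndV u); set z := cabs (thdV u).
move=> z0 y0 x0 xK yK zK.
have -> : a = (3 + (a - 3))%N by rewrite subnKC.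
have -> : b = (2 + (b - 2))%N by rewrite subnKC.
have -> : c = (1 + (c - 1))%N by rewrite subnKC.
rewrite (exprD x 3) (exprD y 2) (exprD z 1) expr1 /e.
rewrite (exprD K (a - 3 + (b - 2))) (exprD K (a - 3)).
have -> : x ^+ 3 * x ^+ (a - 3) * (y ^+ 2 * y ^+ (b - 2)) * (z * z ^+ (c - 1)) =
  (x ^+ (a - 3) * y ^+ (b - 2) * z ^+ (c - 1)) * (x ^+ 3 * (y ^+ 2 * z)) by ring.
have pw v n : 0 <= v -> v <= K -> v ^+ n <= K ^+ n.
  by move=> v0 vK; rewrite lerXn2r.
have xx n := exprn_ge0 n x0; have yy n := exprn_ge0 n y0; have zz n := exprn_ge0 n z0.
apply: ler_pM; rewrite ?mulr_ge0 //.
  by rewrite !ler_pM ?mulr_ge0 ?pw.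
rewrite -mulrDr ler_wpM2l //.
have [yz|zy] := leP y z.
  have : y ^+ 2 <= z ^+ 2 by rewrite lerXn2r.
  by move=> /(ler_wpM2r z0); have := yy 3; lra.
by have := ler_wpM2l (yy 2) (ltW zy); have := zz 3; lra.
Qed.

Lemma summable_triP a b c :
  [|| (2 < a) && (2 < b), (2 < a) && (2 < c), (2 < b) && (2 < c),
      [&& 2 < a, 1 < b & 0 < c], [&& 2 < a, 1 < c & 0 < b],
      [&& 2 < b, 1 < a & 0 < c], [&& 2 < b, 1 < c & 0 < a],
      [&& 2 < c, 1 < a & 0 < b] | [&& 2 < c, 1 < b & 0 < a]]%N ->
  summable_tri a b c.
Proof.
have sw := summable_swap; have tu := summable_turn.
have b33 := summable_tri33; have b321 := summable_tri321.
case/or4P => [H|H|H|/or4P[H|H|H|/or3P[H|H|H]]]; first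
  [ by apply: b33; lia | by apply: (sw); apply: (tu); apply: b33; lia
  | by apply: (tu); apply: b33; lia
  | by apply: b321; lia | by apply: (sw); apply: b321; lia | by apply: (tu); apply: b321; lia
  | by apply: (sw); apply: (tu); apply: b321; lia | by apply: (tu); apply: (sw); apply: b321; lia
  | by apply: (sw); apply: (tu); apply: (sw); apply: b321; lia ].
Qed.

Lemma has_trisum a b c : summable_tri a b c -> has_sum (tri a b c) (trisum a b c).
Proof. by case=> M /has_sum_tsum. Qed.

Lemma trisum_relation a b c :
  summable_tri a b.+1 c.+1 -> summable_tri a.+1 b c.+1 -> summable_tri a.+1 b.+1 c ->
  trisum a b.+1 c.+1 + trisum a.+1 b c.+1 + trisum a.+1 b.+1 c = 0.
Proof.
move=> /has_trisum h1 /has_trisum h2 /has_trisum h3.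
apply: (has_sum_unique (has_sumD (has_sumD h1 h2) h3)).
apply: eq_has_sum (@has_sum0 R _) => u; rewrite /tri !exprS.
transitivity (fstV u ^+ a * sndV u ^+ b * thdV u ^+ c *
  (sndV u * thdV u + fstV u * thdV u + fstV u * sndV u)); last by ring.
by rewrite tri_relation mulr0.
Qed.

(** Among pairs of nonzero points, [generic] removes exactly the pairs [(p, - p)] from the product
    of the two lattice sums, and these add up to [(-1)^b G_(a+b)]. *)
Lemma trisum0 a b : (3 <= a)%N -> (3 <= b)%N ->
  trisum a b 0 = gsum tau a * gsum tau b - (-1) ^+ b * gsum tau (a + b).
Proof.
move=> a3 b3.
have [M HM] := latt_abs_le t0 a3; have [N HN] := latt_abs_le t0 b3.
have H := has_sumM HM HN (has_gsum t0 a3) (has_gsum t0 b3).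
pose f u : C := if u.1 + u.2 == 0 then latt tau u.1 ^- a * latt tau u.2 ^- b else 0.
have H' : has_sum f ((-1) ^+ b * gsum tau (a + b)).
  apply: (has_sum_reindex (h := fun p : int * int => (p, - p))).
  - by move=> p q [].
  - move=> [p q]; rewrite /f /=; case: ifP => [/eqP pq _|]; last by rewrite eqxx.
    by exists p; congr pair; apply/esym/eqP; rewrite -addr_eq0 addrC pq.
  apply: eq_has_sum (has_sumZ ((-1) ^+ b) (has_gsum t0 (leq_trans a3 (leq_addr b a)))) => p.
  rewrite /f /= subrr eqxx lattN -!exprVn exprD invrN [(- (latt _ _)^-1) ^+ b]exprNn.
  by ring.
apply: tsumE; apply: eq_has_sum (has_sumB H H') => -[p q] /=.
rewrite /f /tri /fstV /sndV /generic /= expr0 mulr1.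
have z n : (3 <= n)%N -> (0 : C) ^+ n = 0 by move=> n3; rewrite expr0n gtn_eqF //; lia.
have [->|p0] := eqVneq p 0; first by rewrite latt0 !z // invr0 !mul0r if_same subr0.
have [->|q0] := eqVneq q 0; first by rewrite latt0 !z // invr0 !mulr0 if_same subr0.
case: eqP => _ /=; first by rewrite !z // mul0r subrr.
by rewrite subr0 !exprVn.
Qed.

(** The lower bounds on [n] in [symmetric_telescope] keep out exponents such as [(w - 2, 1, 1)],
    which [summable_triP] does not cover. *)
Lemma trisum_recursion w : (8 <= w)%N -> ~~ odd w ->
  \sum_(3 <= i < w - 2) (-1) ^+ i * (i%:R - 1) * (w%:R - 1 - i%:R) * trisum (w - i) i 0 =
  - 4 * trisum (w - 3) 3 0.
Proof.
move=> w8 ew.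
apply: (@symmetric_telescope w (fun i => trisum (w - i) i 0)
  (fun i => trisum (w - 1 - i) i 1) (fun i => trisum (w - 2 - i) i 2)
  (fun i => trisum (w - 3 - i) i 3) w8 ew) => /=.
- move=> n n2 nw; have := @trisum_relation (w - 2 - n) n 0.
  have -> : ((w - 2 - n).+1 = w - 1 - n)%N by lia.
  have -> : (w - 1 - n.+1 = w - 2 - n)%N by lia.
  have -> : (w - n.+1 = w - 1 - n)%N by lia.
  by move=> H; apply/eqP; rewrite -addr_eq0 H //; apply: summable_triP; lia.
- move=> n n2 nw; have := @trisum_relation (w - 3 - n) n 1.
  have -> : ((w - 3 - n).+1 = w - 2 - n)%N by lia.
  have -> : (w - 2 - n.+1 = w - 3 - n)%N by lia.
  have -> : (w - 1 - n.+1 = w - 2 - n)%N by lia.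
  by move=> H; apply/eqP; rewrite -addr_eq0 H //; apply: summable_triP; lia.
- move=> n n2 nw; have := @trisum_relation (w - 4 - n) n 2.
  have -> : ((w - 4 - n).+1 = w - 3 - n)%N by lia.
  have -> : (w - 3 - n.+1 = w - 4 - n)%N by lia.
  have -> : (w - 2 - n.+1 = w - 3 - n)%N by lia.
  by move=> H; apply/eqP; rewrite -addr_eq0 H //; apply: summable_triP; lia.
- rewrite trisum_swap trisum_turn trisum_swap.
  by congr trisum; clear -w8; lia.
- rewrite trisum_swap trisum_turn trisum_swap.
  by congr trisum; clear -w8; lia.
- rewrite trisum_swap trisum_turn trisum_swap.
  by congr trisum; clear -w8; lia.
- by rewrite trisum_swap; congr trisum; clear -w8; lia.
- by rewrite trisum_swap; congr trisum; clear -w8; lia.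
- by rewrite trisum_turn trisum_swap; congr trisum; clear -w8; lia.
- by rewrite trisum_swap; congr trisum; clear -w8; lia.
Qed.

(** The right side of [trisum_recursion] is [- 4 G_w] because [G_3 = 0]. On the left every [i], odd
    or even, returns [- rec_coef w i] times [G_w], while the products survive for even [i] only. *)
Lemma gsum_recursion w : (8 <= w)%N -> ~~ odd w ->
  \sum_(3 <= i < w - 2 | ~~ odd i) (rec_coef w i)%:C * (gsum tau i * gsum tau (w - i)) =
  (\sum_(3 <= i < w - 2) rec_coef w i - 4)%:C * gsum tau w.
Proof.
move=> w8 ew; have := trisum_recursion w8 ew.
rewrite trisum0; [|lia|lia].
rewrite (gsum_odd t0 (w := 3)) // mulr0 sub0r subnK; last by lia.
have -> : - 4 * - ((-1) ^+ 3 * gsum tau w) = - 4 * gsum tau w by ring.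
move=> H; rewrite rmorphB rmorph_sum mulrBl rmorph_nat /= -mulNr -H.
rewrite big_distrl /= -big_split [LHS]big_mkcond /=.
apply: eq_big_nat => i /andP[i3 iw].
rewrite trisum0; [|lia|lia].
rewrite subnK; last by lia.
rewrite /rec_coef !rmorphM !rmorphB /= !rmorph_nat rmorph1 -signr_odd.
case: (boolP (odd i)) => oi /=; last by rewrite expr0; ring.
by rewrite (gsum_odd t0 i3) // expr1; ring.
Qed.

End Recursion.

(** * Power sums determine their terms *)

Section PowerSums.
Variable R : realType.
Local Notation C := R[i].

(** More than [M / r^2] indices with [|a i| >= r] would push the sum of squares above [M]. *)
Lemma finite_above (I : choiceType) (a : I -> C) M r :
  abs_le (fun i => a i ^+ 2) M -> 0 < r ->
  exists2 A : seq I, uniq A & forall i, i \notin A -> cabs (a i) < r.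
Proof.
move=> aM r0; apply: contrapT => H.
have next (A : seq I) : uniq A -> exists2 i, i \notin A & r <= cabs (a i).
  move=> uA; apply: contrapT => H'; apply: H; exists A => // i iA.
  by rewrite ltNge; apply/negP => h; apply: H'; exists i.
have large n : exists s : seq I, [/\ uniq s, size s = n & forall i, i \in s -> r <= cabs (a i)].
  elim: n => [|n [s [us ss Hs]]]; first by exists [::].
  have [i iNs ri] := next s us; exists (i :: s); split => /=.
  - by rewrite iNs us.
  - by rewrite ss.
  - by move=> j; rewrite inE => /orP[/eqP ->|/Hs].
have M0 := abs_le_ge0 aM.
have r2 : 0 < r ^+ 2 by rewrite exprn_gt0.
have [s [us ss Hs]] := large (Num.bound (M / r ^+ 2)).
have := aM s us; apply/negP; rewrite -ltNge.
apply: (@lt_le_trans _ _ (\sum_(i <- s) r ^+ 2)).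
  rewrite big_const_seq count_predT iter_addr addr0 -[_ *+ size s]mulr_natl ss.
  by rewrite -ltr_pdivrMr // archi_boundP // divr_ge0 // ltW.
rewrite big_seq [leRHS]big_seq; apply: ler_sum => i /Hs ri.
by rewrite cabsX lerXn2r ?nnegrE ?cabs_ge0 // ltW.
Qed.

Lemma has_sum_big (I J : choiceType) (F : J -> I -> C) (l : J -> C) (s : seq J) :
  (forall j, has_sum (F j) (l j)) ->
  has_sum (fun i => \sum_(j <- s) F j i) (\sum_(j <- s) l j).
Proof.
move=> H; elim: s => [|j s IH].
  by rewrite big_nil; apply: eq_has_sum (@has_sum0 R I) => i; rewrite big_nil.
rewrite big_cons; apply: eq_has_sum (has_sumD (H j) IH) => i.
by rewrite big_cons.
Qed.

Lemma has_sum_poly (I : choiceType) (a : I -> C) (S : nat -> C) (P : {poly C}) m :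
  (forall n, (m <= n)%N -> has_sum (fun i => a i ^+ n) (S n)) ->
  has_sum (fun i => a i ^+ m * P.[a i]) (\sum_(j < size P) P`_j * S (m + j)%N).
Proof.
move=> H.
have := @has_sum_big I _ (fun (j : 'I_(size P)) i => P`_j * a i ^+ (m + j))
  (fun j => P`_j * S (m + j)%N) (index_enum _).
move=> /(_ _)/eq_has_sum; apply=> [i|j].
  rewrite horner_coef big_distrr /=; apply: eq_bigr => j _.
  by rewrite exprD mulrCA.
by apply: has_sumZ; apply: H; rewrite leq_addr.
Qed.

Lemma poly_disk_bound (P : {poly C}) r : 0 <= r ->
  exists2 B, 0 <= B & forall z, cabs z <= r -> cabs P.[z] <= B.
Proof.
move=> r0; exists (\sum_(j < size P) cabs P`_j * r ^+ j).
  by rewrite sumr_ge0 // => j _; rewrite mulr_ge0 ?cabs_ge0 ?exprn_ge0.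
move=> z zr; rewrite horner_coef (le_trans (cabs_sum _ _)) //.
apply: ler_sum => j _; rewrite cabsM cabsX ler_wpM2l ?cabs_ge0 //.
by rewrite lerXn2r ?nnegrE ?cabs_ge0.
Qed.

Lemma has_sum_tail (I : choiceType) (a : I -> C) M (A : seq I) r B (P : {poly C}) m T :
  abs_le (fun i => a i ^+ 2) M -> uniq A -> (forall i, i \notin A -> cabs (a i) < r) ->
  0 <= r -> 0 <= B -> (forall z, cabs z <= r -> cabs P.[z] <= B) ->
  has_sum (fun i => a i ^+ (m + 2) * P.[a i]) T ->
  cabs (T - \sum_(i <- A) a i ^+ (m + 2) * P.[a i]) <= r ^+ m * B * M.
Proof.
move=> aM uA Ar r0 B0 HB HT.
pose f i := a i ^+ (m + 2) * P.[a i].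
have HA : has_sum (fun i => if i \in A then f i else 0) (\sum_(i <- A) f i).
  have -> : \sum_(i <- A) f i = \sum_(i <- A) (if i \in A then f i else 0).
    by rewrite big_seq [RHS]big_seq; apply: eq_bigr => i ->.
  by apply: has_sum_finite => // i /negbTE ->.
apply: has_sum_le (has_sumB HT HA) => s us.
rewrite (le_trans _ (ler_wpM2l _ (aM s us))) ?mulr_ge0 ?exprn_ge0 //.
rewrite big_distrr; apply: ler_sum => i _ /=; rewrite -/(f i).
case: (boolP (i \in A)) => iA.
  by rewrite subrr cabs0 !mulr_ge0 ?exprn_ge0 ?cabs_ge0.
have /ltW ir := Ar i iA.
rewrite subr0 /f exprD mulrAC cabsM ler_wpM2r ?cabs_ge0 // cabsM.
apply: ler_pM; rewrite ?cabs_ge0 ?HB //.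
by rewrite cabsX lerXn2r ?nnegrE ?cabs_ge0.
Qed.

(* A polynomial kills the finitely many other values of modulus at least [|v|/2];
   the surviving term grows like [|v|^m] against a remainder [O((|v|/2)^m)]. *)
Lemma power_sums_values (I J : choiceType) (a : I -> C) (b : J -> C) M N (S : nat -> C) :
  abs_le (fun i => a i ^+ 2) M -> abs_le (fun j => b j ^+ 2) N ->
  (forall m, (2 <= m)%N -> has_sum (fun i => a i ^+ m) (S m)) ->
  (forall m, (2 <= m)%N -> has_sum (fun j => b j ^+ m) (S m)) ->
  forall i, a i != 0 -> exists j, b j = a i.
Proof.
move=> aM bN aS bS i0 v0; set v := a i0 in v0 *; apply: contrapT => nb.
have {}nb j : b j != v by apply: contra_notN nb => /eqP; exists j.
pose r := cabs v / 2.
have cv : 0 < cabs v by rewrite cabs_gt0.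
have r0 : 0 < r by rewrite divr_gt0.
have [A uA HA] := finite_above aM r0; have [B uB HB] := finite_above bN r0.
pose P : {poly C} := (\prod_(i <- A) (if a i == v then 1 else 'X - (a i)%:P)) *
  \prod_(j <- B) ('X - (b j)%:P).
have Pv : P.[v] != 0.
  rewrite hornerM !horner_prod mulf_neq0 // prodf_seq_neq0; apply/allP => x _ /=.
    have [_|av] := eqVneq (a x) v; rewrite !hornerE ?oner_eq0 //.
    by rewrite subr_eq0 eq_sym.
  by rewrite !hornerE subr_eq0 eq_sym.
have PA i : i \in A -> a i != v -> P.[a i] = 0.
  move=> iA av; rewrite hornerM !horner_prod (big_rem i) //= (negbTE av).
  by rewrite !hornerE subrr !mul0r.
have PB j : j \in B -> P.[b j] = 0.
  move=> jB; rewrite hornerM !horner_prod [X in _ * X](big_rem j) //=.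
  by rewrite hornerXsubC subrr mul0r mulr0.
have [K K0 HK] := poly_disk_bound P (ltW r0).
have i0A : i0 \in A.
  apply: contraT => /HA; rewrite -/v ltNge => /negP[].
  by rewrite /r ler_pdivrMr // ler_peMr ?ltW // ltr1n.
(* The value [v] occurs several times, for instance at opposite lattice points; its [n] equal terms
   reinforce each other. *)
pose n := count (fun i => a i == v) A.
have n0 : (0 < n)%N by rewrite -has_count; apply/hasP; exists i0 => /=.
have key m : cabs v ^+ 2 * cabs P.[v] * 2 ^+ m <= K * (M + N).
  pose T := \sum_(j < size P) P`_j * S (m + 2 + j)%N.
  have Ta : has_sum (fun i => a i ^+ (m + 2) * P.[a i]) T.
    by apply: has_sum_poly => l hl; apply: aS; lia.
  have Tb : has_sum (fun j => b j ^+ (m + 2) * P.[b j]) T.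
    by apply: has_sum_poly => l hl; apply: bS; lia.
  have := has_sum_tail aM uA HA (ltW r0) K0 HK Ta.
  have := has_sum_tail bN uB HB (ltW r0) K0 HK Tb.
  have -> : \sum_(j <- B) b j ^+ (m + 2) * P.[b j] = 0.
    by rewrite big_seq big1 // => j /PB ->; rewrite mulr0.
  have -> : \sum_(i <- A) a i ^+ (m + 2) * P.[a i] = n%:R * (v ^+ (m + 2) * P.[v]).
    rewrite (bigID (fun i => a i == v)) /= [X in _ + X]big1_seq ?addr0.
      rewrite -big_filter (eq_big_seq (fun _ => v ^+ (m + 2) * P.[v])).
        by rewrite big_const_seq count_predT iter_addr addr0 size_filter mulr_natl.
      by move=> i; rewrite mem_filter => /andP[/eqP ->].
    by move=> i /andP[av iA]; rewrite PA ?mulr0.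
  rewrite subr0; set w := n%:R * _ => hb ha.
  have : cabs w <= r ^+ m * K * (M + N).
    have -> : w = T - (T - w) by ring.
    rewrite (le_trans (cabsB _ _)) // mulrDr addrC lerD //.
  rewrite /w !cabsM !cabsX => hw.
  have n1 : 1 <= cabs (n%:R : C).
    by rewrite -(rmorph_nat (real_complex R)) cabs_real ger0_norm // (ler_nat _ 1).
  have {hw} : cabs v ^+ (m + 2) * cabs P.[v] <= r ^+ m * K * (M + N).
    by apply: le_trans hw; rewrite ler_peMl // mulr_ge0 ?exprn_ge0 ?cabs_ge0.
  have -> : cabs v ^+ (m + 2) * cabs P.[v] =
     r ^+ m * (cabs v ^+ 2 * cabs P.[v] * 2 ^+ m).
    rewrite exprD; have -> : cabs v = r * 2 by rewrite /r divfK.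
    by rewrite !exprMn; ring.
  by rewrite -[r ^+ m * K * _]mulrA ler_pM2l ?exprn_gt0.
have c0 : 0 < cabs v ^+ 2 * cabs P.[v] by rewrite mulr_gt0 ?exprn_gt0 ?cabs_gt0.
have MN : 0 <= K * (M + N) by rewrite mulr_ge0 // addr_ge0 ?(abs_le_ge0 aM) ?(abs_le_ge0 bN).
pose m := Num.bound (K * (M + N) / (cabs v ^+ 2 * cabs P.[v])).
have := key m; apply/negP; rewrite -ltNge [ltRHS]mulrC -ltr_pdivrMr //.
apply: (lt_le_trans (archi_boundP _)); first by rewrite divr_ge0 // ltW.
by rewrite -natrX ler_nat ltnW // ltn_expl.
Qed.

End PowerSums.

(** * Lattices are determined by their fourth and sixth power sums *)

Section Homothety.
Variable R : realType.
Local Notation C := R[i].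
Implicit Types tau : C.

Lemma gsum_scale tau tau' (kappa : C) : 0 < Im tau -> 0 < Im tau' ->
  gsum tau' 4 = kappa ^+ 2 * gsum tau 4 ->
  gsum tau' 6 = kappa ^+ 3 * gsum tau 6 ->
  forall m, (2 <= m)%N -> gsum tau' (2 * m) = kappa ^+ m * gsum tau (2 * m).
Proof.
move=> t0 t0' h4 h6; elim/ltn_ind => m IH m2.
have [->|m2'] := eqVneq m 2%N; first exact: h4.
have [->|m3'] := eqVneq m 3%N; first exact: h6.
have w8 : (8 <= 2 * m)%N by lia.
have ew : ~~ odd (2 * m) by rewrite mul2n odd_double.
have := gsum_recursion t0' w8 ew; have := gsum_recursion t0 w8 ew.
set c := (_ - 4)%:C => h h'.
have c0 : c != 0.
  rewrite /c -(rmorph0 (real_complex R)) (inj_eq (@complexI R)) gt_eqF //.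
  by rewrite subr_gt0 rec_coef_sum_gt.
apply: (mulfI c0); rewrite -h' mulrCA -h big_distrr /=.
rewrite big_nat_cond [RHS]big_nat_cond.
apply: eq_bigr => i /andP[/andP[i3 iw] /negbTE oi].
have ei : i = (2 * i./2)%N by rewrite mul2n -[LHS]odd_double_half oi.
rewrite ei -mulnBr !IH; [|lia..].
have -> : m = (i./2 + (m - i./2))%N by lia.
by rewrite exprD addKn; ring.
Qed.

(** The numbers [1 / lambda'^2] and [kappa / lambda^2] have equal power sums, so each value of the
    first family occurs in the second. That [kappa] is nonzero comes out as a conclusion:
    [gsum46_neq0] takes [kappa = 0] to exclude a common zero of [G_4] and [G_6]. *)
Lemma homothetic_values tau tau' (kappa : C) : 0 < Im tau -> 0 < Im tau' ->
  gsum tau' 4 = kappa ^+ 2 * gsum tau 4 ->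
  gsum tau' 6 = kappa ^+ 3 * gsum tau 6 ->
  forall p, p != 0 -> exists q, latt tau q ^+ 2 = kappa * latt tau' p ^+ 2 /\ kappa != 0.
Proof.
move=> t0 t0' h4 h6 p p0.
have [M HM] := latt_abs_le t0' (isT : (3 <= 4)%N).
have [N HN] := latt_abs_le t0 (isT : (3 <= 4)%N).
have Hp : (latt tau' p)^-1 ^+ 2 != 0 by rewrite expf_neq0 // invr_neq0 // latt_eq0.
have [||m m2|m m2|q Hq] := power_sums_values (a := fun p => (latt tau' p)^-1 ^+ 2)
  (b := fun q => kappa * (latt tau q)^-1 ^+ 2) (M := M) (N := cabs (kappa ^+ 2) * N)
  (S := fun m => gsum tau' (2 * m)) _ _ _ _ Hp.
- by apply: abs_le_dom HM _ => q; rewrite -exprM exprVn.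
- by apply: abs_le_dom (abs_leZ (kappa ^+ 2) HN) _ => q; rewrite exprMn -exprM exprVn.
- apply: eq_has_sum (has_gsum t0' (_ : (3 <= 2 * m)%N)); last by lia.
  by move=> q; rewrite -exprM exprVn.
- rewrite (gsum_scale t0 t0' h4 h6 m2).
  apply: eq_has_sum (has_sumZ (kappa ^+ m) (has_gsum t0 (_ : (3 <= 2 * m)%N))); last by lia.
  by move=> q; rewrite exprMn -exprM exprVn.
exists q.
have : kappa * (latt tau q)^-1 ^+ 2 != 0 by rewrite Hq.
rewrite mulf_eq0 negb_or expf_eq0 /= invr_eq0 => /andP[k0 q0]; split => //.
have p0' : latt tau' p != 0 by rewrite latt_eq0.
have -> : kappa = (latt tau' p)^-1 ^+ 2 * latt tau q ^+ 2.
  by rewrite -Hq exprVn mulfVK // expf_neq0.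
by field.
Qed.

Lemma gsum46_neq0 tau : 0 < Im tau -> gsum tau 4 = 0 -> gsum tau 6 <> 0.
Proof.
move=> t0 g4 g6.
have h4 : gsum tau 4 = 0 ^+ 2 * gsum tau 4 by rewrite g4 mulr0.
have h6 : gsum tau 6 = 0 ^+ 3 * gsum tau 6 by rewrite g6 mulr0.
have [q [_]] := homothetic_values t0 t0 h4 h6 (isT : ((0, 1) : int * int) != 0).
by rewrite eqxx.
Qed.

(** The fundamental domain, with its boundary conventions, phrased by [cabs tau ^+ 2] so that the
    conditions are polynomial in the coordinates. *)
Definition reduced tau := [/\ 0 < Im tau, 1 <= cabs tau ^+ 2,
  - 2^-1 <= Re tau < 2^-1 & Re tau <= 0 \/ 1 < cabs tau ^+ 2].

(** As [|2 x| <= 1], the form is at least [a^2 - |a b| + b^2], a positive integer. *)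
Lemma quadratic_form_ge1 (p : int * int) (x : R) : p != 0 -> - 2^-1 <= x <= 2^-1 ->
  1 <= p.1%:~R ^+ 2 + 2 * p.1%:~R * p.2%:~R * x + p.2%:~R ^+ 2 :> R.
Proof.
case: p => a b /= p0 /andP[x1 x2].
have h : (1 <= a ^+ 2 - `|a * b| + b ^+ 2)%R by
  move: p0; rewrite -pair_eqE /= /pair_eq /= ; nia.
have {}h : 1 <= a%:~R ^+ 2 - `|a%:~R * b%:~R| + b%:~R ^+ 2 :> R.
  by move: h; rewrite -(ler_int R) rmorphD rmorphB /= !rmorphXn /= intr_norm rmorphM.
apply: (le_trans h); rewrite lerD2r lerD2l.
rewrite lerNl -!mulNr (le_trans (ler_norm _)) //.
have -> : - 2 * a%:~R * b%:~R * x = (a%:~R * b%:~R) * (- (2 * x)) :> R by ring.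
rewrite normrM ler_piMr // ler_norml; lra.
Qed.

Lemma cabs_latt tau p : cabs (latt tau p) ^+ 2 =
  p.1%:~R ^+ 2 * cabs tau ^+ 2 + 2 * p.1%:~R * p.2%:~R * Re tau + p.2%:~R ^+ 2.
Proof. by rewrite !cabs_sqr Re_latt Im_latt; ring. Qed.

Lemma cabs_latt_ge1 tau p : reduced tau -> p != 0 -> 1 <= cabs (latt tau p) ^+ 2.
Proof.
case=> t0 t1 /andP[x1 x2] _ p0.
apply: le_trans (@quadratic_form_ge1 p (Re tau) p0 _) _; first by rewrite x1 ltW.
by rewrite cabs_latt !lerD2r ler_peMr ?sqr_ge0.
Qed.

(** * One-sided comparison of two reduced lattices *)

Section OneSided.
Variables (tau tau' kappa : C).
Hypotheses (rt : reduced tau) (rt' : reduced tau').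
Hypothesis sub_latt : forall p, p != 0 ->
  exists q, latt tau q ^+ 2 = kappa * latt tau' p ^+ 2 /\ kappa != 0.

(** The images of the basis vectors 1 and [tau'] are known only up to sign, since only squares are
    compared; the sign of [c] is adjusted to that of [a]. *)
Lemma homothety_basis : exists a c : int * int, [/\ kappa = latt tau a ^+ 2, a != 0 &
   latt tau c = latt tau a * tau'].
Proof.
have t0 : 0 < Im tau by case: rt.
have [a [ka k0]] := @sub_latt (0, 1) isT.
have ea : kappa = latt tau a ^+ 2.
  by rewrite ka /latt /= mul0r add0r expr1n mulr1.
have a0 : a != 0 by rewrite -(latt_eq0 _ t0) -sqrf_eq0 -ea.
have [c [kc _]] := @sub_latt (1, 0) isT.
have : latt tau c ^+ 2 = (latt tau a * tau') ^+ 2.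
  by rewrite exprMn -ea kc /latt /= mul1r addr0.
move/eqP; rewrite eqf_sqr => /orP[/eqP H|/eqP H]; first by exists a, c.
by exists a, (- c); split => //; rewrite lattN H opprK.
Qed.

(** [kappa] is the square of a nonzero vector of a reduced lattice. Used in both directions, this
    gives [|kappa| = 1]. *)
Lemma homothety_ratio_ge1 : 1 <= cabs kappa.
Proof.
have [a [c [-> a0 _]]] := homothety_basis.
by rewrite cabsX cabs_latt_ge1.
Qed.

(** [tau'] is a quotient of lattice points whose denominator has modulus 1, so [Im tau'] is [Im tau]
    times a positive integer determinant. In case of equality, either [a.1] is nonzero and
    [|latt tau a| = 1] forces [|tau| = 1], or [latt tau a] is 1 or -1 and [tau'] is a translate of
    [tau] inside the same strip. *)
Lemma homothety_im : cabs kappa = 1 -> Im tau <= Im tau' /\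
  (Im tau' = Im tau -> cabs tau ^+ 2 = 1 \/ tau' = tau).
Proof.
have [a [c [-> a0 cE]]] := homothety_basis; rewrite cabsX => ka.
case: rt => t0 t1 /andP[x1 x2] x3; case: rt' => t0' t1' /andP[x1' x2'] x3'.
have im : Im tau' = (c.1 * a.2 - a.1 * c.2)%:~R * Im tau.
  have : latt tau c * (latt tau a)^*%C = (cabs (latt tau a) ^+ 2)%:C * tau'.
    rewrite cE mulrAC -sqr_normc normr_cabs; by rewrite rmorphXn.
  rewrite ka mul1r => <-.
  have : forall u v : C, Im (u * v^*%C) = Im u * Re v - Re u * Im v.
    by case=> [? ?] [? ?] /=; ring.
  by move=> ->; rewrite !Im_latt !Re_latt rmorphB !rmorphM /=; ring.
have det : 1 <= (c.1 * a.2 - a.1 * c.2)%:~R :> R.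
  have : 0 < (c.1 * a.2 - a.1 * c.2)%:~R :> R.
    by rewrite -(pmulr_lgt0 _ t0) -im.
  by rewrite ltr0z (ler_int R 1) gtz0_ge1.
split=> [|e]; first by rewrite im ler_peMl // ltW.
have [a10|a10] := eqVneq a.1 0; last first.
  left; apply/eqP; rewrite eq_le t1 andbT leNgt; apply/negP => h.
  have := ka; rewrite cabs_latt.
  have := @quadratic_form_ge1 a (Re tau) a0.
  rewrite x1 ltW // => /(_ isT) q.
  have a1 : 0 < a.1%:~R ^+ 2 :> R by rewrite exprn_even_gt0 //= intr_eq0.
  have := mulr_gt0 a1 (_ : 0 < cabs tau ^+ 2 - 1); rewrite subr_gt0 => /(_ h) => h1 h2.
  by move: q h1 h2; set A := cabs tau ^+ 2; lra.
right.
have a21 : a.2 = 1 \/ a.2 = -1.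
  have := ka; rewrite cabs_latt a10 !(mul0r, mulr0, expr0n, add0r) /= => /eqP.
  rewrite sqrf_eq1 => /orP[] /eqP h; [left|right]; apply/eqP.
    by rewrite -(eqr_int R) h.
  by rewrite -(eqr_int R) h.
have c1 : c.1 * a.2 = 1.
  have := im; rewrite a10 mul0r subr0 e => /esym/eqP.
  rewrite -[X in _ == X]mul1r => /eqP/(mulIf (lt0r_neq0 t0)) h.
  by apply/eqP; rewrite -(eqr_int R) h.
have La : latt tau a = a.2%:~R by rewrite /latt a10 mul0r add0r.
have tE : tau' = tau + (a.2 * c.2)%:~R.
  have a2 : a.2%:~R * a.2%:~R = 1 :> C.
    by rewrite -rmorphM /=; case: a21 => ->.
  have c1' : c.1 = a.2 by case: a21 => h; move: c1; rewrite h => h1; clear -h1; lia.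
  transitivity (a.2%:~R * (a.2%:~R * tau')); first by rewrite mulrA a2 mul1r.
  have -> : a.2%:~R * tau' = latt tau c by rewrite cE La.
  by rewrite /latt c1' mulrDr mulrA a2 mul1r intrM.
move: x1' x2' ; rewrite tE intrC raddfD /= => h1 h2.
suff -> : a.2 * c.2 = 0 by rewrite addr0.
have : (a.2 * c.2)%:~R < 1 :> R by lra.
have : - 1 < (a.2 * c.2)%:~R :> R by lra.
rewrite -[-1 in X in X -> _](rmorphN1 (intr : int -> R)) (ltr_int R (-1)).
rewrite (ltr_int R _ 1) => u v; clear -u v; lia.
Qed.

End OneSided.

Lemma reduced_homothety_eq tau tau' : reduced tau -> reduced tau' ->
  gsum tau 4 ^+ 3 * gsum tau' 6 ^+ 2 = gsum tau' 4 ^+ 3 * gsum tau 6 ^+ 2 ->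
  tau = tau'.
Proof.
move=> rt rt' E; have t0 : 0 < Im tau by case: rt.
have t0' : 0 < Im tau' by case: rt'.
(* If one of the two sums vanishes, [kappa] is a cube or square root of the ratio of the other;
   otherwise it is the ratio in weight 6 over the ratio in weight 4, as
   [kappa^3 / kappa^2 = kappa]. *)
have [kappa [k0 h4 h6]] : exists kappa, [/\ kappa != 0,
    gsum tau' 4 = kappa ^+ 2 * gsum tau 4 & gsum tau' 6 = kappa ^+ 3 * gsum tau 6].
  have [g4|g4] := eqVneq (gsum tau 4) 0.
    have /eqP g6 := gsum46_neq0 t0 g4.
    have g4' : gsum tau' 4 = 0.
      move: E; rewrite g4 expr0n mul0r => /esym/eqP.
      by rewrite mulf_eq0 !expf_eq0 /= (negbTE g6) orbF => /eqP.
    have /eqP g6' := gsum46_neq0 t0' g4'.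
    have n3 : (0 < 3)%N by [].
    exists (3.-root (gsum tau' 6 / gsum tau 6)).
    by rewrite rootC_eq0 // mulf_neq0 ?invr_neq0 // g4 g4' mulr0 rootCK // mulfVK.
  have [g6|g6] := eqVneq (gsum tau 6) 0.
    have g6' : gsum tau' 6 = 0.
      move: E; rewrite g6 [0 ^+ 2]expr0n mulr0 => /eqP.
      by rewrite mulf_eq0 !expf_eq0 /= (negbTE g4) => /eqP.
    have g4' : gsum tau' 4 != 0.
      by apply/eqP => h; exact: gsum46_neq0 t0' h g6'.
    exists (2.-root (gsum tau' 4 / gsum tau 4)).
    by rewrite rootC_eq0 // mulf_neq0 ?invr_neq0 // g6 g6' mulr0 rootCK // mulfVK.
  have g4' : gsum tau' 4 != 0.
    apply/eqP => h; move/eqP: E; rewrite h expr0n mul0r mulf_eq0 !expf_eq0 /= (negbTE g4) /=.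
    by move=> /eqP; exact: gsum46_neq0 t0' h.
  have g6' : gsum tau' 6 != 0.
    apply/eqP => h; move/eqP: E; rewrite h [0 ^+ 2]expr0n mulr0 eq_sym.
    by rewrite mulf_eq0 !expf_eq0 /= (negbTE g6) (negbTE g4').
  exists ((gsum tau' 6 / gsum tau 6) / (gsum tau' 4 / gsum tau 4)); split.
  - by rewrite !mulf_neq0 ?invr_neq0 ?mulf_neq0 ?invr_neq0.
  - apply: (mulfI (expf_neq0 2 g4')); rewrite -exprSr.
    have -> : gsum tau' 4 ^+ 3 = gsum tau 4 ^+ 3 * gsum tau' 6 ^+ 2 / gsum tau 6 ^+ 2.
      by rewrite E mulfK // expf_neq0.
    by field; rewrite g4 g4' g6.
  - have E' : gsum tau 4 ^+ 3 / gsum tau' 4 ^+ 3 = gsum tau 6 ^+ 2 / gsum tau' 6 ^+ 2.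
      apply/eqP; rewrite eqr_div ?expf_neq0 // E; apply/eqP; ring.
    transitivity (gsum tau 6 ^+ 2 / gsum tau' 6 ^+ 2 * gsum tau' 6 ^+ 3 / gsum tau 6 ^+ 2).
      by field; rewrite g6 g6'.
    by rewrite -E'; field; rewrite g4 g4' g6.
have H := homothetic_values t0 t0' h4 h6.
have h4' : gsum tau 4 = kappa^-1 ^+ 2 * gsum tau' 4.
  by rewrite h4 exprVn mulKf // expf_neq0.
have h6' : gsum tau 6 = kappa^-1 ^+ 3 * gsum tau' 6.
  by rewrite h6 exprVn mulKf // expf_neq0.
have H' := homothetic_values t0' t0 h4' h6'.
have k1 := homothety_ratio_ge1 rt H.
have k1' := homothety_ratio_ge1 rt' H'.
have ck : 0 < cabs kappa by rewrite cabs_gt0.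
have ck1 : cabs kappa = 1.
  by apply/eqP; rewrite eq_le k1 andbT -(invf_ge1 ck) -cabsV.
have [i1 n1] := homothety_im rt rt' H ck1.
have [|i2 n2] := homothety_im rt' rt H'; first by rewrite cabsV ck1 invr1.
have ei : Im tau = Im tau' by apply/eqP; rewrite eq_le i1 i2.
(* It remains that both points lie on the left half of the unit circle at the same height, so their
   real parts agree too. *)
have [c1|//] := n1 (esym ei); have [c1'|//] := n2 ei.
case: rt => _ _ _ [x|]; last by rewrite c1 ltxx.
case: rt' => _ _ _ [x'|]; last by rewrite c1' ltxx.
have : Re tau ^+ 2 = Re tau' ^+ 2.
  by move: c1 c1'; rewrite !cabs_sqr ei => <- /addIr.
rewrite -(sqrrN (Re tau)) -(sqrrN (Re tau')) => /eqP.
rewrite eqrXn2 ?oppr_ge0 // eqr_opp => /eqP er.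
by apply/eqP; rewrite eq_complex er ei !eqxx.
Qed.

Lemma fundamental_domain_reduced tau : fundamental_domain tau -> reduced tau.
Proof.
have n1 : (1 < `|tau|) -> 1 < cabs tau ^+ 2.
  rewrite normr_cabs -(rmorph1 (real_complex R)) ltcR => h.
  by rewrite exprn_egt1.
have n2 : (1 <= `|tau|) -> 1 <= cabs tau ^+ 2.
  rewrite normr_cabs -(rmorph1 (real_complex R)) lecR => h.
  by rewrite exprn_ege1.
move=> [[/= t0 [/n1 h1 /andP[h2 h3]]]|[/= t0 [/n2 h1 /andP[h2 h3]]]]; split => //.
- exact: ltW.
- by apply/andP; split => //; lra.
- by right.
- by apply/andP; split => //; lra.
- by left.
Qed.

End Homothety.

(** * Forms as isobaric polynomials *)

Section EisensteinLattice.
Variable R : realType.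
Local Notation C := R[i].
Implicit Types tau : C.

Lemma coprime_abs_le tau w : 0 < Im tau -> (3 <= w)%N ->
  exists M, abs_le (fun c : coprime_pair => latt tau (val c) ^- w) M.
Proof.
move=> t0 w3; have [M HM] := latt_abs_le t0 w3.
by exists M; exact: (abs_le_comp val_inj HM).
Qed.

Lemma has_sum_eisenstein tau w : 0 < Im tau -> (3 <= w)%N ->
  has_sum (fun c : coprime_pair => latt tau (val c) ^- w) (2 * eisenstein w tau).
Proof.
move=> t0 w3; have [M /has_sum_tsum H] := coprime_abs_le t0 w3.
by rewrite /eisenstein (summability_sumE H) mulrA divff ?pnatr_eq0 // mul1r.
Qed.

(** [z] is the zeta value at [w], nonzero because partial sums containing the first term are at
    least 1. *)
Lemma zeta_exists w : (3 <= w)%N -> exists z : R,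
  [/\ z != 0, has_sum (fun n => (n.+1%:R ^- w)%:C) z%:C &
      exists M, abs_le (fun n => (n.+1%:R ^- w : R)%:C) M].
Proof.
move=> w3.
have HM : abs_le (fun n => (n.+1%:R ^- w : R)%:C) 4.
  move=> s us.
  have -> : \sum_(n <- s) cabs (n.+1%:R ^- w : R)%:C =
      \sum_(n <- map S s) root_weight R n ^+ (2 * w).
    rewrite big_map; apply: eq_bigr => n _.
    rewrite cabs_real ger0_norm ?invr_ge0 ?exprn_ge0 // exprM root_weight_sqr.
    by rewrite exprVn; congr (_%:R ^- _); lia.
  apply: sum_root_weight; first by lia.
  by rewrite map_inj_uniq // => x y [].
have z0 n : 0 <= n.+1%:R ^- w :> R by rewrite invr_ge0 exprn_ge0.
have [z Hz] := has_sum_nonneg z0 HM.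
exists z; split=> //; last by exists 4.
apply/eqP => ez; have [s [us s0 Hs]] := has_sum_near Hz ltr01 [:: 0%N].
move: Hs; rewrite ez subr0 -rmorph_sum cabs_real ger0_norm ?sumr_ge0 //.
apply/negP; rewrite -leNgt.
rewrite -[leLHS](_ : \sum_(n <- [:: 0%N]) n.+1%:R ^- w = 1); last first.
  by rewrite big_seq1 expr1n invr1.
exact: ler_sum_sub.
Qed.

(** Every nonzero pair is, in a unique way, a positive multiple of a coprime pair, the multiplier
    being its gcd; this reindexes the product of the zeta series and the coprime series. *)
Lemma gsum_eisenstein tau w : 0 < Im tau -> (3 <= w)%N -> forall z : R,
  has_sum (fun n => (n.+1%:R ^- w)%:C) z%:C ->
  (exists M, abs_le (fun n => (n.+1%:R ^- w : R)%:C) M) ->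
  gsum tau w = 2 * z%:C * eisenstein w tau.
Proof.
move=> t0 w3 z Hz [N HN].
have [M HM] := coprime_abs_le t0 w3.
have H := has_sumM HN HM Hz (has_sum_eisenstein t0 w3).
pose h (u : nat * coprime_pair) : int * int :=
  (u.1.+1%:Z * (val u.2).1, u.1.+1%:Z * (val u.2).2).
have hg u : gcdz (h u).1 (h u).2 = u.1.+1.
  by rewrite /h /= -mulz_gcdr; have /eqP -> := valP u.2; rewrite mulr1.
have hE : gsum tau w = z%:C * (2 * eisenstein w tau); last by rewrite hE; ring.
apply: (has_sum_unique (has_gsum t0 w3)).
apply: (has_sum_reindex (h := h)).
- move=> u v E; have e1 : u.1 = v.1 by have := hg u; rewrite E hg => -[].
  case: u v E e1 => [n c] [n' c'] /= E en; subst n'; congr pair.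
  case: E => /mulfI E1 /mulfI E2; apply: val_inj => /=.
  by rewrite [LHS]surjective_pairing [RHS]surjective_pairing E1 // E2.
- move=> p; rewrite invr_eq0 expf_eq0 negb_and -leqNgt leqn0.
  rewrite gtn_eqF ?(ltn_trans _ w3) //= latt_eq0 // => p0.
  set g := gcdz p.1 p.2.
  have g0 : g != 0.
    rewrite gcdz_eq0; apply: contra p0 => /andP[/eqP p1 /eqP p2].
    by rewrite [p]surjective_pairing p1 p2.
  have gE : g = `|g|%:Z by rewrite /g /gcdz.
  have e1 : (p.1 %/ g)%Z * g = p.1 by rewrite divzK // dvdz_gcdl.
  have e2 : (p.2 %/ g)%Z * g = p.2 by rewrite divzK // dvdz_gcdr.
  have cop : coprimez ((p.1 %/ g)%Z, (p.2 %/ g)%Z).1 ((p.1 %/ g)%Z, (p.2 %/ g)%Z).2.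
    rewrite /coprimez /=; apply/eqP/(mulIf g0).
    have := mulz_gcdl (p.1 %/ g)%Z (p.2 %/ g)%Z g.
    by rewrite -gE e1 e2 mul1r.
  exists (`|g|.-1, exist (fun q : int * int => coprimez q.1 q.2) _ cop); rewrite /h /=.
  have -> : `|g|.-1.+1%:Z = g by rewrite prednK ?absz_gt0 // -gE.
  by rewrite ![g * _]mulrC e1 e2 -surjective_pairing.
- apply: eq_has_sum H => -[n c] /=.
  rewrite -[X in _ = X ^- w](_ : (n.+1%:R : C) * latt tau (val c) = _).
    by rewrite exprMn invfM rmorphV ?unitfE ?expf_neq0 // rmorphXn rmorph_nat.
  rewrite /latt /h /= !intrM -!pmulrn; ring.
Qed.

End EisensteinLattice.

(** * Weighted polynomials in [G_4] and [G_6] *)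

Section Isobaric.
Variable R : realType.
Local Notation C := R[i].
Implicit Types tau : C.

(** Polynomials of weight [w] in variables of weights 4 and 6, encoded as functions built from
    monomials; closure properties and the reduction to one variable then follow by induction. *)
Inductive isobaric : nat -> (C -> C -> C) -> Prop :=
| isobaric0 w : isobaric w (fun _ _ => 0)
| isobaricX i j : isobaric (4 * i + 6 * j) (fun x y => x ^+ i * y ^+ j)
| isobaricD w f g : isobaric w f -> isobaric w g ->
    isobaric w (fun x y => f x y + g x y)
| isobaricZ w (c : C) f : isobaric w f -> isobaric w (fun x y => c * f x y).

Lemma isobaric_eq w f g : (forall x y, f x y = g x y) -> isobaric w f -> isobaric w g.
Proof.
move=> E; suff -> : f = g by [].
by apply/funext => x; apply/funext => y.
Qed.

Lemma isobaricM v w f g : isobaric v f -> isobaric w g ->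
  isobaric (v + w) (fun x y => f x y * g x y).
Proof.
move=> Hf Hg; elim: Hf => {v f} [v|i j|v f f' _ IH _ IH'|v c f _ IH].
- by apply: isobaric_eq (isobaric0 _) => x y; rewrite mul0r.
- elim: Hg => {w g} [w|i' j'|w g g' _ IH _ IH'|w c g _ IH].
  + by apply: isobaric_eq (isobaric0 _) => x y; rewrite mulr0.
  + have -> : (4 * i + 6 * j + (4 * i' + 6 * j') = 4 * (i + i') + 6 * (j + j'))%N by lia.
    by apply: isobaric_eq (isobaricX _ _) => x y; rewrite !exprD; ring.
  + by apply: isobaric_eq (isobaricD IH IH') => x y; rewrite mulrDr.
  + by apply: isobaric_eq (isobaricZ c IH) => x y; rewrite mulrCA.
- by apply: isobaric_eq (isobaricD IH IH') => x y; rewrite mulrDl.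
- by apply: isobaric_eq (isobaricZ c IH) => x y; rewrite mulrA.
Qed.

Lemma isobaricXn w n f : isobaric w f -> isobaric (n * w) (fun x y => f x y ^+ n).
Proof.
move=> Hf; elim: n => [|n IH].
  rewrite mul0n; apply: isobaric_eq (isobaricX 0 0) => x y.
  by rewrite !expr0 mulr1.
by rewrite mulSn; apply: isobaric_eq (isobaricM Hf IH) => x y; rewrite exprS.
Qed.

Definition isobaric_fun w (F : C -> C) := exists2 f, isobaric w f &
  forall tau, 0 < Im tau -> F tau = f (gsum tau 4) (gsum tau 6).

Lemma gsum_isobaric m : (2 <= m)%N -> isobaric_fun (2 * m) (fun tau => gsum tau (2 * m)).
Proof.
elim/ltn_ind: m => m IH m2.
have [->|m2'] := eqVneq m 2%N.
  exists (fun x y => x ^+ 1 * y ^+ 0); first exact: (isobaricX 1 0).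
  by move=> tau _; rewrite expr1 expr0 mulr1.
have [->|m3'] := eqVneq m 3%N.
  exists (fun x y => x ^+ 0 * y ^+ 1); first exact: (isobaricX 0 1).
  by move=> tau _; rewrite expr1 expr0 mul1r.
have w8 : (8 <= 2 * m)%N by lia.
have ew : ~~ odd (2 * m) by rewrite mul2n odd_double.
have [S HS SE] : isobaric_fun (2 * m) (fun tau =>
    \sum_(3 <= i < 2 * m - 2 | ~~ odd i)
       (rec_coef R (2 * m) i)%:C * (gsum tau i * gsum tau (2 * m - i))).
  have : forall i, i \in index_iota 3 (2 * m - 2) -> (3 <= i < 2 * m - 2)%N.
    by move=> i; rewrite mem_index_iota.
  elim: (index_iota _ _) => [_|i s IHs Hs].
    exists (fun _ _ => 0); first exact: isobaric0.
    by move=> tau _; rewrite big_nil.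
  have [S HS SE] := IHs (fun j js => Hs j (@mem_behead _ (i :: s) j js)).
  have [oi|ei] := boolP (odd i).
    by exists S => // tau t0; rewrite big_cons oi /= SE.
  have /andP[i3 iw] : (3 <= i < 2 * m - 2)%N by apply: Hs; rewrite mem_head.
  have iE : i = (2 * i./2)%N by rewrite mul2n -[LHS]odd_double_half (negbTE ei).
  have [||f Hf fE] := IH i./2; [lia..|].
  have [||g Hg gE] := IH (m - i./2)%N; [lia..|].
  exists (fun x y => (rec_coef R (2 * m) i)%:C * (f x y * g x y) + S x y).
    apply: isobaricD HS; apply: isobaricZ.
    have -> : (2 * m = 2 * i./2 + 2 * (m - i./2))%N by lia.
    exact: isobaricM.
  move=> tau t0; rewrite big_cons ei /= SE // -fE // -gE // mulnBr -iE //.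
set c : C := (\sum_(3 <= i < 2 * m - 2) rec_coef R (2 * m) i - 4)%:C.
have c0 : c != 0.
  rewrite /c -(rmorph0 (real_complex R)) (inj_eq (@complexI R)) gt_eqF //.
  by rewrite subr_gt0 rec_coef_sum_gt.
exists (fun x y => c^-1 * S x y); first exact: isobaricZ.
move=> tau t0; rewrite -SE // (gsum_recursion t0 w8 ew) -/c mulrA mulVf //.
by rewrite mul1r.
Qed.

Lemma eisenstein_isobaric w : (4 <= w)%N -> ~~ odd w -> isobaric_fun w (eisenstein w).
Proof.
move=> w4 ew; have wE : w = (2 * w./2)%N by rewrite mul2n -[LHS]odd_double_half (negbTE ew).
have w3 : (3 <= w)%N by lia.
have [|f Hf fE] := @gsum_isobaric w./2; first by lia.
have [z [z0 Hz HM]] := zeta_exists R w3.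
exists (fun x y => (2 * z%:C)^-1 * f x y); first by apply: isobaricZ; rewrite wE.
move=> tau t0; rewrite -fE // -wE (gsum_eisenstein t0 w3 Hz HM) mulrA mulVf ?mul1r //.
by rewrite mulf_neq0 ?pnatr_eq0 // -(rmorph0 (real_complex R)) (inj_eq (@complexI R)).
Qed.

(** The homogenization of [Q] in degree [n], evaluated at [(x^3, y^2)]. *)
Definition homog n (Q : {poly C}) (x y : C) : C :=
  \sum_(i < n.+1) Q`_i * (x ^+ (3 * i) * y ^+ (2 * (n - i))).

Lemma homog_horner n (Q : {poly C}) x y : (size Q <= n.+1)%N -> y != 0 ->
  homog n Q x y = y ^+ (2 * n) * Q.[x ^+ 3 / y ^+ 2].
Proof.
move=> sQ y0; rewrite (horner_coef_wide _ sQ) big_distrr /=; apply: eq_bigr => i _.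
rewrite expr_div_n -!exprM [RHS]mulrCA; congr (_ * _).
have -> : (2 * n = 2 * (n - i) + 2 * i)%N by have := ltn_ord i; lia.
by rewrite [y ^+ (_ + _)]exprD; field; rewrite expf_neq0.
Qed.

(** For a monomial, [4 i + 6 j = 12 n + 4 a + 6 b] forces [i = a] modulo 3 and [j = b] modulo 2, so
    [x^a y^b] factors out and cubes and squares remain. *)
Lemma isobaric_homog n a b f : (a < 3)%N -> (b < 2)%N ->
  isobaric (12 * n + 4 * a + 6 * b) f -> exists2 Q : {poly C}, (size Q <= n.+1)%N &
  forall x y, f x y = x ^+ a * y ^+ b * homog n Q x y.
Proof.
move=> a3 b2; move E : (12 * n + _ + _)%N => w Hf.
elim: Hf E => {w f} [w _|i j E|w f g _ IHf _ IHg /[dup] /IHf[P sP PE] /IHg[Q sQ QE]|w c f _ IHf /IHf[P sP PE]].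
- exists 0; first by rewrite size_poly0.
  move=> x y; rewrite /homog big1 ?mulr0 // => i _; by rewrite coef0 mul0r.
- pose i' := (i %/ 3)%N; have i'n : (i' < n.+1)%N by rewrite /i'; lia.
  exists 'X^i'; first by rewrite size_polyXn.
  move=> x y; rewrite /homog (bigD1 (Ordinal i'n)) //= coefXn eqxx mul1r.
  rewrite big1 ?addr0 => [|k]; last first.
    by rewrite -val_eqE /= coefXn => /negbTE ->; rewrite mul0r.
  have -> : i = (a + 3 * i')%N by rewrite /i'; lia.
  have -> : j = (b + 2 * (n - i'))%N by rewrite /i'; lia.
  by rewrite !exprD; ring.
- exists (P + Q); first by rewrite (leq_trans (size_polyD _ _)) // geq_max sP sQ.
  move=> x y; rewrite PE QE -mulrDr /homog -big_split /=; congr (_ * _).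
  by apply: eq_bigr => i _; rewrite coefD mulrDl.
- exists (c *: P); first by rewrite (leq_trans (size_scale_leq _ _)).
  move=> x y; rewrite PE mulrCA /homog; congr (_ * _); rewrite big_distrr /=.
  by apply: eq_bigr => i _; rewrite coefZ mulrA.
Qed.

End Isobaric.

(** * The zeros of [G_4] and [G_6], and the count of the other zeros *)

Section SpecialPoints.
Variable R : realType.
Local Notation C := R[i].

(** [h] is multiplication by [u] written in coordinates. Where the lattice has such a symmetry and
    [u^w] differs from 1, the sum vanishes. *)
Lemma gsum_unit (tau u : C) w (h g : int * int -> int * int) : 0 < Im tau -> (3 <= w)%N ->
  cancel h g -> cancel g h -> (forall p, latt tau (h p) = u * latt tau p) ->
  gsum tau w = u ^- w * gsum tau w.
Proof.
move=> t0 w3 hg gh E; have H := has_gsum t0 w3.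
apply: (has_sum_unique (has_sum_perm hg gh H)).
by apply: eq_has_sum (has_sumZ (u ^- w) H) => p /=; rewrite E exprMn invfM.
Qed.

Definition rho : C := (- 2^-1) +i* (Num.sqrt 3 / 2).

Lemma rho_sqr : rho ^+ 2 = - 1 - rho.
Proof.
rewrite /rho expr2; simpc; apply/eqP; rewrite eq_complex /=; apply/andP; split; apply/eqP.
  have : Num.sqrt 3 * Num.sqrt 3 = 3 :> R by rewrite -expr2 sqr_sqrtr.
  by move=> h; lra.
by field.
Qed.

Lemma rho_reduced : reduced rho.
Proof.
have h : 0 < Num.sqrt 3 :> R by rewrite sqrtr_gt0.
have h2 : cabs rho ^+ 2 = 1.
  by rewrite cabs_sqr /= exprMn sqr_sqrtr //; field.
split; rewrite ?h2 //=; first by lra.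
by left; lra.
Qed.

Lemma I_reduced : reduced ('i%C : C).
Proof.
have h2 : cabs ('i%C : C) ^+ 2 = 1 by rewrite cabs_sqr /= expr0n expr1n add0r.
split; rewrite ?h2 //=; first by apply/andP; split; lra.
by left.
Qed.

Lemma gsum4_rho : gsum rho 4 = 0.
Proof.
have [t0 _ _ _] := rho_reduced.
have := @gsum_unit rho rho 4 (fun p => (p.2 - p.1, - p.1)) (fun p => (- p.2, p.1 - p.2)) t0 isT.
have c1 : cancel (fun p : int * int => (p.2 - p.1, - p.1)) (fun p => (- p.2, p.1 - p.2)).
  by case=> a b /=; congr pair; lia.
have c2 : cancel (fun p : int * int => (- p.2, p.1 - p.2)) (fun p => (p.2 - p.1, - p.1)).
  by case=> a b /=; congr pair; lia.
have c3 p : latt rho (p.2 - p.1, - p.1) = rho * latt rho p.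
  rewrite /latt /= intrB mulrNz mulrDr [rho * (_ * rho)]mulrCA -expr2 rho_sqr.
  by ring.
move=> /(_ c1 c2 c3).
have -> : rho ^+ 4 = rho.
  have -> : rho ^+ 4 = (rho ^+ 2) ^+ 2 by ring.
  have -> : (rho ^+ 2) ^+ 2 = 1 + 2 * rho + rho ^+ 2 by rewrite {1}rho_sqr; ring.
  by rewrite rho_sqr; ring.
have r0 : rho != 0 by rewrite eq_complex /= negb_and oppr_eq0 invr_eq0 pnatr_eq0.
have r1 : rho - 1 != 0.
  rewrite subr_eq0 eq_complex /= negb_and; apply/orP; left.
  by apply/eqP => h; have : (0 : R) < 1 by []; rewrite -h; lra.
move=> h; have {}h : rho * gsum rho 4 = gsum rho 4 by rewrite {1}h mulVKf.
have := mulf_eq0 (rho - 1) (gsum rho 4).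
by rewrite mulrBl mul1r h subrr eqxx (negbTE r1) => /esym/eqP.
Qed.

Lemma gsum6_i : gsum ('i%C : C) 6 = 0.
Proof.
have [t0 _ _ _] := I_reduced.
have := @gsum_unit 'i%C 'i%C 6 (fun p => (p.2, - p.1)) (fun p => (- p.2, p.1)) t0 isT.
have c1 : cancel (fun p : int * int => (p.2, - p.1)) (fun p => (- p.2, p.1)).
  by case=> a b /=; rewrite opprK.
have c2 : cancel (fun p : int * int => (- p.2, p.1)) (fun p => (p.2, - p.1)).
  by case=> a b /=; rewrite opprK.
have c3 p : latt 'i%C (p.2, - p.1) = 'i%C * latt ('i%C : C) p.
  rewrite /latt /= mulrNz mulrDr [_ * (_ * 'i%C)]mulrCA -expr2 sqr_i.
  by ring.
move=> /(_ c1 c2 c3).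
have -> : ('i%C : C) ^+ 6 = -1.
  by rewrite (exprM _ 2 3) sqr_i exprS sqrrN expr1n mulr1.
rewrite invrN1 mulN1r => h; have : gsum ('i%C : C) 6 *+ 2 == 0.
  by rewrite mulr2n {1}h addNr.
by rewrite mulrn_eq0 /= => /eqP.
Qed.

Lemma gsum4_eq0 (tau : C) : reduced tau -> gsum tau 4 = 0 -> tau = rho.
Proof.
move=> rt g4; apply: (reduced_homothety_eq rt rho_reduced).
by rewrite g4 gsum4_rho !expr0n !mul0r.
Qed.

Lemma gsum6_eq0 (tau : C) : reduced tau -> gsum tau 6 = 0 -> tau = 'i%C.
Proof.
move=> rt g6; apply: (reduced_homothety_eq rt I_reduced).
by rewrite g6 gsum6_i !expr0n !mulr0.
Qed.

(* Off [rho] and [i] the value of the form is, up to nonzero factors, a polynomial of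
   degree at most [n] in [G4^3 / G6^2], and this quotient separates reduced points. *)
Lemma reduced_zeros n a b (F : C -> C) (s : seq C) (tau1 : C) :
  (a < 3)%N -> (b < 2)%N -> isobaric_fun (12 * n + 4 * a + 6 * b) F ->
  uniq s -> size s = n ->
  (forall t, t \in s -> [/\ reduced t, t != rho, t != 'i%C & F t = 0]) ->
  reduced tau1 -> F tau1 != 0 ->
  forall tau, reduced tau -> F tau = 0 -> [\/ tau \in s, tau = rho | tau = 'i%C].
Proof.
move=> a3 b2 [f Hf fE] us ss Hs rt1 F1 tau rt Ft.
have [Q sQ QE] := isobaric_homog a3 b2 Hf.
have Q0 : Q != 0.
  apply: contraNneq F1 => Q0; rewrite fE; last by case: rt1.
  by rewrite QE /homog big1 ?mulr0 // => i _; rewrite Q0 coef0 mul0r.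
have [ts|tNs] := boolP (tau \in s); first by apply: Or31.
have [->|tr] := eqVneq tau rho; first by apply: Or32.
have [->|ti] := eqVneq tau 'i%C; first by apply: Or33.
exfalso; pose J t : C := gsum t 4 ^+ 3 / gsum t 6 ^+ 2.
have H t : t \in tau :: s -> [/\ reduced t, gsum t 4 != 0, gsum t 6 != 0 & F t = 0].
  rewrite inE => /orP[/eqP ->|/Hs[r1 r2 r3 r4]]; split => //.
  - by apply: contraNneq tr => /(gsum4_eq0 rt) ->.
  - by apply: contraNneq ti => /(gsum6_eq0 rt) ->.
  - by apply: contraNneq r2 => /(gsum4_eq0 r1) ->.
  - by apply: contraNneq r3 => /(gsum6_eq0 r1) ->.
have uJ : uniq (map J (tau :: s)).
  rewrite map_inj_in_uniq /= ?tNs // => x y /H[rx _ x6 _] /H[ry _ y6 _] /eqP.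
  rewrite /J eqr_div ?expf_neq0 // => /eqP E.
  exact: reduced_homothety_eq rx ry E.
have rJ : all (root Q) (map J (tau :: s)).
  apply/allP => _ /mapP[t /H[rt' g4 g6 Ft'] ->]; rewrite rootE.
  move: Ft'; rewrite fE; last by case: rt'.
  rewrite QE homog_horner // => /eqP.
  by rewrite !mulf_eq0 !expf_eq0 (negbTE g4) (negbTE g6) !andbF.
have := max_poly_roots Q0 rJ uJ.
by rewrite size_map /= ss; apply/negP; rewrite -leqNgt.
Qed.

End SpecialPoints.

(** * Estimates on the unit arc *)

Section Trigonometry.
Variable R : realType.
Implicit Types x : R.

Lemma cos_mul2 x : cos (2 * x) = 2 * cos x ^+ 2 - 1.
Proof. by rewrite mulr_natl cos_mulr2n mulr_natl. Qed.

Lemma cos_mul3 x : cos (3 * x) = 4 * cos x ^+ 3 - 3 * cos x.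
Proof.
have -> : 3 * x = 2 * x + x by ring.
rewrite cosD cos_mul2 [2 * x]mulr_natl sin_mulr2n.
have := sin2cos2 x => h.
have -> : cos x * sin x *+ 2 * sin x = 2 * cos x * sin x ^+ 2 by ring.
by rewrite h; ring.
Qed.

Lemma cos_natpi m : cos (m%:R * pi) = (-1) ^+ m :> R.
Proof.
elim: m => [|m IH]; first by rewrite mul0r cos0.
by rewrite -natr1 mulrDl mul1r cosDpi IH exprS mulN1r.
Qed.

(** The triple angle formula becomes [(c + 1) (2 c - 1)^2 = 0], and [c] is positive. *)
Lemma cos_pi3 : cos (pi / 3) = 2^-1 :> R.
Proof.
have h := cos_mul3 (pi / 3); move: h; rewrite mulrC divfK ?pnatr_eq0 // cospi => h.
have c0 : 0 < cos (pi / 3 : R).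
  by apply: cos_gt0_pihalf; have := pi_gt0 R => p; apply/andP; split; lra.
have : (cos (pi / 3 : R) + 1) * (2 * cos (pi / 3 : R) - 1) ^+ 2 = 0.
  transitivity (4 * cos (pi / 3 : R) ^+ 3 - 3 * cos (pi / 3 : R) + 1); first by ring.
  by rewrite -h addNr.
move/eqP; rewrite mulf_eq0 gt_eqF ?addr_gt0 //= sqrf_eq0 subr_eq0 => /eqP e.
by apply: (@mulfI _ 2); rewrite ?e ?divff ?pnatr_eq0.
Qed.

Lemma sin_pi3 : sin (pi / 3) = Num.sqrt 3 / 2 :> R.
Proof.
have s0 : 0 < sin (pi / 3 : R).
  by apply: sin_gt0_pi; have := pi_gt0 R => p; apply/andP; split; lra.
have t0 : 0 <= Num.sqrt 3 / 2 :> R by rewrite divr_ge0 ?sqrtr_ge0.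
apply/eqP; rewrite -(@eqrXn2 _ 2) //; last exact: ltW.
by rewrite sin2cos2 cos_pi3 exprMn sqr_sqrtr //; apply/eqP; field.
Qed.

Lemma sin_pi6 : sin (pi / 6) = 2^-1 :> R.
Proof.
by rewrite -[RHS]cos_pi3 -cosBpihalf -cosN; congr cos; field.
Qed.

Lemma cos_2pi3 : cos (2 * pi / 3) = - 2^-1 :> R.
Proof. by rewrite -mulrA cos_mul2 cos_pi3; field. Qed.

Lemma sin_2pi3 : sin (2 * pi / 3) = Num.sqrt 3 / 2 :> R.
Proof.
by rewrite -mulrA mulr_natl sin_mulr2n cos_pi3 sin_pi3; field.
Qed.

Lemma sin_le_id x : 0 <= x -> sin x <= x.
Proof.
move=> x0; have [|c _] := @MVT_segment R (@sin R) (@cos R) 0 x x0.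
  by apply: continuous_subspaceT => y; exact: continuous_sin.
by rewrite sin0 !subr0 => ->; rewrite ler_piMl ?cos_le1.
Qed.

(** Used backwards, as a lower bound for the sine of a small angle with a known multiple. *)
Lemma sin_natmul n x : `|sin (n%:R * x)| <= n%:R * `|sin x|.
Proof.
elim: n => [|n IH]; first by rewrite !mul0r sin0 normr0.
rewrite -natr1 !mulrDl !mul1r sinD (le_trans (ler_normD _ _)) // !normrM.
have c1 (y : R) : `|cos y| <= 1 by rewrite ler_norml cos_geN1 cos_le1.
apply: lerD; first by apply: le_trans IH; rewrite ler_piMr ?c1.
by rewrite ler_piMl ?c1.
Qed.

Lemma cos_ge_parabola x : 0 <= x -> x <= 2 -> 1 - x ^+ 2 / 2 <= cos x.
Proof.
move=> x0 x2; have -> : cos x = 1 - 2 * sin (x / 2) ^+ 2.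
  have {1}-> : x = 2 * (x / 2) by field.
  by rewrite cos_mul2 cos2sin2; ring.
have h : sin (x / 2) <= x / 2 by rewrite sin_le_id // divr_ge0.
have s0 : 0 <= sin (x / 2).
  by apply: sin_ge0_pi; have := pi_ge2 R => p; apply/andP; split; lra.
by nra.
Qed.

Lemma sqrt3_ge : 17 / 10 <= Num.sqrt 3 :> R.
Proof.
have := @sqrtr_ge0 R 3; have := @sqr_sqrtr R 3 (ler0n _ 3).
by set t := Num.sqrt _ => h1 h2; nra.
Qed.

(** For [d = pi / (6 N)] the left factor is [cos d + sqrt 3 sin d]. From [sin (N d) = 1/2] comes
    [sin d >= 1 / (2 N)], a gain of at least [17/20 / N]; the loss [d^2 / 2] is at most [1/36 / N]
    for [N >= 8], and [17/20 - 1/36 > 41/50]. *)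
Lemma cos_near_pi3 (N : nat) : (8 <= N)%N ->
  1 + 41 / 50 / N%:R <= 2 * cos (pi / 3 - pi / 6 / N%:R) :> R.
Proof.
move=> N8; have N8' : 8 <= N%:R :> R by rewrite (ler_nat _ 8).
set t : R := N%:R^-1.
have t0 : 0 < t by rewrite invr_gt0; lra.
have t8 : t <= 8^-1 by rewrite lef_pV2 ?posrE //; lra.
set d := pi / 6 * t.
have p2 := pihalf_lt2 R; have p0 := pi_gt0 R; have p3 := pi_ge2 R.
have d0 : 0 <= d by rewrite mulr_ge0 ?divr_ge0 // ltW.
have dt : d <= 2 / 3 * t by rewrite /d ler_wpM2r ?(ltW t0) //; lra.
have sd : t / 2 <= sin d.
  have := sin_natmul N d.
  have -> : N%:R * d = pi / 6 by rewrite /d /t; field; lra.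
  rewrite sin_pi6 (@ger0_norm _ 2^-1) ?invr_ge0 //.
  rewrite (@ger0_norm _ (sin d)); last first.
    by apply: sin_ge0_pi; rewrite d0 /=; lra.
  move=> h; have -> : sin d = t * (N%:R * sin d) by rewrite mulKf // gt_eqF //; lra.
  by rewrite ler_wpM2l // ltW.
have cd := cos_ge_parabola d0 _; have {}cd := cd (_ : d <= 2).
have s3 := sqrt3_ge.
rewrite cosD cosN sinN cos_pi3 sin_pi3.
have c1 : 1 - d ^+ 2 / 2 <= cos d by apply: cd; lra.
have dd : d ^+ 2 <= 4 / 9 * t ^+ 2 by nra.
have tt : t ^+ 2 <= t / 8 by nra.
have : Num.sqrt 3 * (t / 2) <= Num.sqrt 3 * sin d by rewrite ler_wpM2l ?sqrtr_ge0.
have : 17 / 10 * (t / 2) <= Num.sqrt 3 * (t / 2) by rewrite ler_wpM2r // ltW // divr_gt0.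
lra.
Qed.

(** Multiplying the truncation for [n] by [1 + x] exceeds the truncation for [n + 1] by exactly
    [n (n - 1) (n - 2) x^4 / 6]. The cubic term is kept for [cube_diag_bound]. *)
Lemma binomial3_le (n : nat) x : 0 <= x ->
  1 + n%:R * x + n%:R * (n%:R - 1) / 2 * x ^+ 2 +
  n%:R * (n%:R - 1) * (n%:R - 2) / 6 * x ^+ 3 <= (1 + x) ^+ n.
Proof.
move=> x0; elim: n => [|n IH]; first by rewrite expr0; lra.
have x1 : 0 <= 1 + x by lra.
rewrite [(1 + x) ^+ n.+1]exprS; apply: le_trans (ler_wpM2l x1 IH).
rewrite -natr1 -subr_ge0.
have -> : forall a : R, (1 + x) * (1 + a * x + a * (a - 1) / 2 * x ^+ 2 +
    a * (a - 1) * (a - 2) / 6 * x ^+ 3) -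
   (1 + (a + 1) * x + (a + 1) * (a + 1 - 1) / 2 * x ^+ 2 +
    (a + 1) * (a + 1 - 1) * (a + 1 - 2) / 6 * x ^+ 3) =
   (a * (a - 1) * (a - 2)) * (x ^+ 4 / 6) by move=> a; field.
rewrite mulr_ge0 ?divr_ge0 ?exprn_ge0 //.
case: n {IH} => [|[|n]]; [by rewrite !mul0r | by rewrite subrr mulr0 mul0r|].
by rewrite -natr1 -natr1 !mulr_ge0 //; have := ler0n R n; lra.
Qed.

(* The contribution of the pairs [(1,1)] and [(-1,-1)] to [e^(i h x) E_(2h)(e^(i x))]. *)
Definition diag_term h x : R := (2 + 2 * cos x) ^- h.

(** At the largest allowed angle, [2 + 2 cos] is the square of the quantity bounded in
    [cos_near_pi3], and the cosine decreases on [[0, pi]]. *)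
Lemma diag_term_le h (N : nat) x : (8 <= N)%N -> 0 <= x ->
  x <= 2 * (pi / 3 - pi / 6 / N%:R) ->
  diag_term h x <= (1 + 41 / 50 / N%:R) ^- (2 * h).
Proof.
move=> N8 x0 xN; set y := 1 + _.
have N8' : 8 <= N%:R :> R by rewrite (ler_nat _ 8).
have y0 : 0 < y by rewrite addr_gt0 // divr_gt0 //; lra.
have p0 := pi_gt0 R.
have h1 : 0 <= pi / 6 / N%:R :> R by rewrite !divr_ge0 // ltW.
have base : y ^+ 2 <= 2 + 2 * cos x.
  apply: (@le_trans _ _ (2 + 2 * cos (2 * (pi / 3 - pi / 6 / N%:R)))).
    rewrite cos_mul2; set c := cos _; have : y <= 2 * c by exact: cos_near_pi3.
    by nra.
  rewrite lerD2l ler_wpM2l // leNgt ltr_cos ?in_itv /=; [|apply/andP; split; lra..].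
  by rewrite -leNgt.
rewrite /diag_term exprM; have b0 : 0 < 2 + 2 * cos x.
  by rewrite (lt_le_trans _ base) ?exprn_gt0.
rewrite lef_pV2 ?posrE ?exprn_gt0 //.
by rewrite lerXn2r ?nnegrE ?exprn_ge0 // ltW.
Qed.

End Trigonometry.

(** * Double series of inverse powers over the sign quadrants *)

Section InversePowerSums.
Variable R : realType.

(** For [n >= 2], [n^-h <= 4 * 2^-h / n^2], and the inverse squares from 2 on add up to at most 3/4
    by telescoping; the index 0 contributes 0. *)
Lemma sum_inv_pow h s : (2 <= h)%N -> uniq s ->
  \sum_(n <- s) (n%:R : R) ^- h <= 1 + 3 * 2 ^- h.
Proof.
move=> h2; apply: sum_nat_le => [n|N]; first by rewrite invr_ge0 exprn_ge0.
set e : R := 2 ^- h; have e0 : 0 < e by rewrite invr_gt0 exprn_gt0.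
have step n : (2 <= n)%N -> (n%:R : R) ^- h <= 4 * e * (n%:R ^+ 2)^-1.
  move=> n2; have n0 : 0 < n%:R :> R by rewrite ltr0n; lia.
  rewrite /e -(subnK h2) !exprD [_ * 2 ^+ 2]mulrC !invfM.
  have -> : 4 * (2^-1 / 2 / 2 ^+ (h - 2)) = 2 ^- (h - 2) :> R.
    by field; rewrite gt_eqF ?exprn_gt0.
  rewrite ler_wpM2r ?mulr_ge0 ?invr_ge0 // lef_pV2 ?posrE ?exprn_gt0 //.
  by rewrite lerXn2r ?nnegrE // ler_nat.
have main M : \sum_(0 <= n < M.+3) (n%:R : R) ^- h <= 1 + 4 * e * (3 / 4 - M.+2%:R^-1).
  elim: M => [|M IH].
    rewrite !big_nat_recr //= big_nil expr0n gtn_eqF ?(ltn_trans _ h2) //.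
    by rewrite invr0 expr1n invr1 -/e; lra.
  rewrite big_nat_recr //= (le_trans (lerD IH (step _ _))) //.
  have a0 : 0 < M.+2%:R :> R by rewrite ltr0n.
  have b0 : 0 < M.+3%:R :> R by rewrite ltr0n.
  have ab : M.+3%:R = M.+2%:R + 1 :> R by rewrite natr1.
  suff : (M.+3%:R ^+ 2)^-1 <= M.+2%:R^-1 - M.+3%:R^-1 :> R.
    have e4 : 0 <= 4 * e by rewrite mulr_ge0 // ltW.
    by move: (_ ^- 2) (M.+2%:R^-1) (M.+3%:R^-1) => u v t /(ler_wpM2l e4); lra.
  have -> : M.+2%:R^-1 - M.+3%:R^-1 = (M.+2%:R * M.+3%:R)^-1 :> R.
    by rewrite ab; field; rewrite !gt_eqF //; lra.
  rewrite lef_pV2 ?posrE ?mulr_gt0 ?exprn_gt0 // expr2 ler_wpM2r ?ltW //.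
  by rewrite ab; lra.
apply: (@le_trans _ _ (\sum_(0 <= n < N.+3) (n%:R : R) ^- h)).
  rewrite !big_nat_recr //= -!addrA lerDl !addr_ge0 // invr_ge0 exprn_ge0 //.
apply: (le_trans (main N)).
have : 0 < N.+2%:R^-1 :> R by rewrite invr_gt0 ltr0n.
by move: (N.+2%:R^-1) => u /(mulr_gt0 e0); lra.
Qed.

Definition quadrant_sum (h : nat) : R := (1 + 3 * 2 ^- h) ^+ 2.

Lemma sum_pair_inv_pow h (s : seq (nat * nat)) : (2 <= h)%N -> uniq s ->
  \sum_(p <- s) (p.1%:R * p.2%:R : R) ^- h <= quadrant_sum h.
Proof.
move=> h2 us; rewrite /quadrant_sum expr2.
apply: (ler_sum_prod (F := fun p => (p.1%:R * p.2%:R : R) ^- h)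
  (a := fun n => (n%:R : R) ^- h) (b := fun n => (n%:R : R) ^- h)) us.
- by move=> n; rewrite invr_ge0 exprn_ge0.
- by move=> n; rewrite invr_ge0 exprn_ge0.
- by move=> m n /=; rewrite exprMn invfM.
- by move=> t; exact: sum_inv_pow.
- by move=> t; exact: sum_inv_pow.
Qed.

Lemma sum_pair_inv_pow1 h (s : seq (nat * nat)) : (2 <= h)%N -> uniq s ->
  (1, 1)%N \notin s ->
  \sum_(p <- s) (p.1%:R * p.2%:R : R) ^- h <= quadrant_sum h - 1.
Proof.
move=> h2 us s1; rewrite lerBrDl.
have := @sum_pair_inv_pow h ((1, 1)%N :: s) h2.
by rewrite big_cons /= mulr1 expr1n invr1 s1 us; apply.
Qed.

Lemma uniq_abs_quadrant (s : seq (int * int)) (a b : bool) : uniq s ->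
  uniq [seq (`|p.1|%N, `|p.2|%N) | p <- s & ((0 < p.1) == a) && ((0 <= p.2) == b)].
Proof.
move=> us; rewrite map_inj_in_uniq ?filter_uniq // => -[x y] [x' y'].
rewrite !mem_filter /= => /andP[/andP[/eqP h1 /eqP h2] _] /andP[/andP[/eqP h3 /eqP h4] _].
by move=> [e1 e2]; congr pair; lia.
Qed.

(** Dominates [|c e^(i x) + d|^(-2 h)] on the arc. As [cos x] lies in [[-1/2, 0]], the squared
    modulus is at least [|c d|] when [c d > 0] and at least [2 |c d|] when [c d < 0]. *)
Definition offdiag_weight h (p : int * int) : R :=
  (if 0 < p.1 * p.2 then 1 else 2 ^- h) * (`|p.1|%:R * `|p.2|%:R) ^- h.

Lemma int_mul_gt0 (x y : int) : x != 0 -> y != 0 -> (0 < x * y) = ((0 < x) == (0 <= y)).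
Proof.
case: (ltrgtP x 0) => // x0 _; case: (ltrgtP y 0) => // y0 _.
- by rewrite nmulr_rgt0.
- by rewrite nmulr_rgt0 // ltNge (ltW y0).
- by rewrite pmulr_rgt0 // ltNge (ltW y0).
- by rewrite pmulr_rgt0.
Qed.

Lemma sum_offdiag h (s : seq (int * int)) : (2 <= h)%N -> uniq s ->
  (forall p, p \in s -> [/\ p.1 != 0, p.2 != 0, p != (1, 1) & p != (-1, -1)]) ->
  \sum_(p <- s) offdiag_weight h p <=
  2 * (quadrant_sum h - 1 + 2 ^- h * quadrant_sum h).
Proof.
move=> h2 us Hs; set e : R := 2 ^- h; set Z := quadrant_sum h.
have e0 : 0 < e by rewrite invr_gt0 exprn_gt0.
(* The four sign quadrants, both coordinates being nonzero. Those with [a = b] have positive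
   products, and each omits its unit pair [(1, 1)] or [(-1, -1)]. *)
pose q a b := [seq p <- s | ((0 < p.1) == a) && ((0 <= p.2) == b)].
have part a b : a == b -> \sum_(p <- q a b) offdiag_weight h p <= Z - 1.
  move=> /eqP ab; have := sum_pair_inv_pow1 h2 (uniq_abs_quadrant a b us).
  rewrite big_map -/(q a b) => H; apply: le_trans (H _).
    rewrite big_seq [leRHS]big_seq; apply: ler_sum => p.
    rewrite mem_filter => /andP[/andP[/eqP p1 /eqP p2] /Hs[n1 n2 _ _]].
    by rewrite /offdiag_weight int_mul_gt0 // p1 p2 ab eqxx mul1r.
  apply/mapP => -[p]; rewrite mem_filter => /andP[/andP[/eqP p1 /eqP p2] /Hs[n1 n2 n3 n4]].
  case => a1 a2; case: p p1 p2 n1 n2 n3 n4 a1 a2 => x y /= p1 p2 n1 n2 n3 n4 a1 a2.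
  have [[ex ey]|[ex ey]] : (x = 1 /\ y = 1) \/ (x = -1 /\ y = -1).
  - by move: p1 p2; rewrite -ab; case: (a) => h1 h3; lia.
  - by rewrite ex ey eqxx in n3.
  - by rewrite ex ey eqxx in n4.
have part' a b : a != b -> \sum_(p <- q a b) offdiag_weight h p <= e * Z.
  move=> ab; have := sum_pair_inv_pow h2 (uniq_abs_quadrant a b us).
  rewrite big_map -/(q a b) => H; apply: le_trans (ler_wpM2l (ltW e0) H).
  rewrite big_distrr /= big_seq [leRHS]big_seq; apply: ler_sum => p.
  rewrite mem_filter => /andP[/andP[/eqP p1 /eqP p2] /Hs[n1 n2 _ _]].
  by rewrite /offdiag_weight int_mul_gt0 // p1 p2 (negbTE ab).
have -> : \sum_(p <- s) offdiag_weight h p =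
    (\sum_(p <- q true true) offdiag_weight h p + \sum_(p <- q true false) offdiag_weight h p) +
    (\sum_(p <- q false true) offdiag_weight h p + \sum_(p <- q false false) offdiag_weight h p).
  rewrite (bigID (fun p : int * int => 0 < p.1)) /=.
  rewrite (bigID (fun p : int * int => 0 <= p.2)) /=.
  rewrite [X in _ + X = _](bigID (fun p : int * int => 0 <= p.2)) /=.
  by rewrite !big_filter; do !congr (_ + _); apply: eq_bigl => p;
     rewrite !(eqb_id, eqbF_neg).
have := part true true isT; have := part false false isT.
have := part' true false isT; have := part' false true isT.
lra.
Qed.

End InversePowerSums.

(** * Eisenstein series on the unit arc *)

Section UnitArc.
Variable R : realType.
Local Notation C := R[i].
Implicit Types x : R.

Definition expi x : C := cos x +i* sin x.
Arguments expi : simpl never.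
#[local] Arguments conjc : simpl never.

Lemma expiD x y : expi (x + y) = expi x * expi y.
Proof. by rewrite /expi cosD sinD; simpc; congr (_ +i* _); ring. Qed.

Lemma expiX x n : expi x ^+ n = expi (n%:R * x).
Proof.
elim: n => [|n IH]; first by rewrite mul0r /expi cos0 sin0.
by rewrite exprS IH -expiD -natr1; congr expi; ring.
Qed.

Lemma cabs_expi x : cabs (expi x) = 1.
Proof.
apply/eqP; rewrite -(@eqrXn2 _ 2) ?cabs_ge0 // expr1n cabs_sqr /=.
by rewrite cos2Dsin2.
Qed.

Lemma expi_neq0 x : expi x != 0.
Proof. by rewrite -cabs_gt0 cabs_expi. Qed.

Lemma conj_expi x : (expi x)^*%C = (expi x)^-1.
Proof.
apply: (mulIf (expi_neq0 x)); rewrite mulVf ?expi_neq0 //.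
by rewrite mulrC -sqr_normc normr_cabs cabs_expi expr1n.
Qed.

Lemma expiV x : (expi x)^-1 = expi (- x).
Proof. by rewrite -conj_expi /expi cosN sinN. Qed.

Lemma expi_addV x : expi x + (expi x)^-1 = (2 * cos x)%:C.
Proof. by rewrite expiV /expi cosN sinN; simpc; congr (_ +i* _); ring. Qed.

Definition on_arc x := pi / 2 <= x <= 2 * pi / 3.

Lemma on_arc_bounds x : on_arc x -> 0 <= x <= pi.
Proof. by have := pi_gt0 R => p /andP[h1 h2]; apply/andP; split; lra. Qed.

Lemma on_arc_cos x : on_arc x -> - 2^-1 <= cos x <= 0.
Proof.
move=> xa; have /andP[x0 xp] := on_arc_bounds xa; case/andP: xa => x1 x2.
have p0 := pi_gt0 R; rewrite -cos_2pi3 -[X in _ <= _ <= X](@cos_pihalf R).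
apply/andP; split; rewrite leNgt ltr_cos -?leNgt ?in_itv //=; try (apply/andP; split; lra).
Qed.

Lemma on_arc_sin x : on_arc x -> 0 < sin x.
Proof.
move=> /andP[x1 x2]; have p0 := pi_gt0 R; apply: sin_gt0_pi.
by apply/andP; split; lra.
Qed.

Lemma on_arc_reduced x : on_arc x -> reduced (expi x).
Proof.
move=> xa; have /andP[c1 c2] := on_arc_cos xa.
split; rewrite ?cabs_expi ?expr1n //=; first exact: on_arc_sin.
  by rewrite c1 /=; lra.
by left.
Qed.

Lemma arc_unit_arc x : on_arc x -> unit_arc (expi x).
Proof. by move=> xa; exists x => //=; rewrite in_itv. Qed.

Lemma rho_unit_arc : unit_arc (rho R).
Proof.
exists (2 * pi / 3); last by rewrite cos_2pi3 sin_2pi3.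
by have p0 := pi_gt0 R; rewrite /= in_itv /=; apply/andP; split; lra.
Qed.

Lemma i_unit_arc : unit_arc ('i%C : C).
Proof.
exists (pi / 2); last by rewrite cos_pihalf sin_pihalf.
by have p0 := pi_gt0 R; rewrite /= in_itv /=; apply/andP; split; lra.
Qed.

Lemma cabs_latt_expi x (p : int * int) : cabs (latt (expi x) p) ^+ 2 =
  p.1%:~R ^+ 2 + 2 * (p.1%:~R * p.2%:~R) * cos x + p.2%:~R ^+ 2.
Proof. by rewrite cabs_latt cabs_expi /=; ring. Qed.

Lemma cabs_latt_arc_ge x (p : int * int) : on_arc x ->
  (`|p.1| ^ 2 + `|p.2| ^ 2)%:R <= cabs (latt (expi x) p) ^+ 2 +
    (if 0 < p.1 * p.2 then (`|p.1| * `|p.2|)%:R else 0).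
Proof.
move=> xa; have /andP[c1 c2] := on_arc_cos xa.
rewrite cabs_latt_expi; case: p => a b /=.
have sq (z : int) : (`|z| ^ 2)%:R = z%:~R ^+ 2 :> R.
  by rewrite natrX natr_absz intr_norm real_normK ?num_real.
rewrite natrD !sq; set u := a%:~R; set v := b%:~R.
have uv : u * v = (a * b)%:~R by rewrite intrM.
case: ifP => [h|/negbT]; last rewrite -leNgt => h.
  have uv0 : 0 < u * v by rewrite uv ltr0z.
  rewrite natrM !natr_absz !intr_norm -normrM -/u -/v gtr0_norm //; nra.
have uv0 : u * v <= 0 by rewrite uv lerz0.
by nra.
Qed.

Lemma latt_bound_arc x : on_arc x -> latt_bound (expi x) 1.
Proof.
move=> xa p p0; rewrite mul1r.
have := cabs_latt_arc_ge p xa.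
have : (maxn `|p.1| 1 * maxn `|p.2| 1 + `|p.1| * `|p.2| <= `|p.1| ^ 2 + `|p.2| ^ 2)%N.
  have : (0 < `|p.1| + `|p.2|)%N.
    by case: p p0 => a b; rewrite -pair_eqE /pair_eq /=; lia.
  move: `|p.1|%N `|p.2|%N => m n h.
  case: m h => [|m] h; first by case: n h => // n _; rewrite !maxnE; nia.
  case: n h => [|n] h; first by rewrite !maxnE; nia.
  by rewrite !(maxn_idPl _) // addnn -mul2n nat_Cauchy.
rewrite -(ler_nat R) natrD => h1 h2.
have h3 : (if 0 < p.1 * p.2 then (`|p.1| * `|p.2|)%:R else 0) <= (`|p.1| * `|p.2|)%:R :> R.
  by case: ifP.
lra.
Qed.

Lemma latt_offdiag_le x h (p : int * int) : on_arc x -> p.1 != 0 -> p.2 != 0 ->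
  cabs (latt (expi x) p ^- (2 * h)) <= offdiag_weight R h p.
Proof.
move=> xa p1 p2; rewrite cabsV cabsX exprM /offdiag_weight -natrM.
set d := cabs _; set m : R := (_ * _)%:R.
have m0 : 0 < m by rewrite ltr0n muln_gt0 !absz_gt0 p1 p2.
have two : (2 * (`|p.1| * `|p.2|) <= `|p.1| ^ 2 + `|p.2| ^ 2)%N.
  exact: nat_Cauchy.
have := cabs_latt_arc_ge p xa; rewrite -/d.
move: two; rewrite -(ler_nat R) natrM -/m => h1 h2.
case: ifP h2 => _ h2.
  have md : m <= d ^+ 2 by lra.
  have d0 := lt_le_trans m0 md.
  rewrite mul1r lef_pV2 ?posrE ?(exprn_gt0 _ m0) ?(exprn_gt0 _ d0) //.
  by apply: lerXn2r => //; rewrite nnegrE ltW.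
have md : 2 * m <= d ^+ 2 by lra.
have m2 : 0 < 2 * m by rewrite mulr_gt0.
have d0 := lt_le_trans m2 md.
rewrite -invfM -exprMn lef_pV2 ?posrE ?(exprn_gt0 _ m2) ?(exprn_gt0 _ d0) //.
by apply: lerXn2r => //; rewrite nnegrE ltW.
Qed.

(** Extended by 0 to all integer pairs, where swapping coordinates and splitting off a finite list
    are direct. *)
Definition coprime_term (tau : C) w (p : int * int) : C :=
  if coprimez p.1 p.2 then latt tau p ^- w else 0.

Lemma has_sum_coprime (tau : C) w : 0 < Im tau -> (3 <= w)%N ->
  has_sum (coprime_term tau w) (2 * eisenstein w tau).
Proof.
move=> t0 w3; apply: (has_sum_reindex (h := val : coprime_pair -> int * int)).
- exact: val_inj.
- move=> p; rewrite /coprime_term; case: ifP => [cp _|]; last by rewrite eqxx.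
  by exists (exist (fun q : int * int => coprimez q.1 q.2) p cp).
- apply: eq_has_sum (has_sum_eisenstein t0 w3) => c.
  by rewrite /coprime_term /= (valP c).
Qed.

(** The factor [e^(i h x)] makes the value real on the arc, so that zeros can be found from
    signs. *)
Definition arc_eisenstein h x : C := expi x ^+ h * eisenstein (2 * h) (expi x).

Lemma conj_cabs (z : C) : cabs (z^*)%C = cabs z.
Proof. by apply: complexI; rewrite -!normr_cabs normcJ. Qed.

Lemma has_sum_conj (I : choiceType) (f : I -> C) l : has_sum f l ->
  has_sum (fun i => (f i)^*%C) l^*%C.
Proof.
move=> fl e e0; have [A HA] := fl e e0; exists A => s us As.
by rewrite -rmorph_sum -rmorphB conj_cabs HA.
Qed.

(** For [u = e^(i x)] the conjugate of [b u + a] is [u^-1 (a u + b)]. Swapping the coordinates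
    therefore turns the conjugate of [E_(2h)] into [u^(2h) E_(2h)]. *)
Lemma arc_eisenstein_real h x : on_arc x -> (2 <= h)%N ->
  arc_eisenstein h x = (Re (arc_eisenstein h x))%:C.
Proof.
move=> xa h2; set z := arc_eisenstein h x.
suff zc : z^*%C = z.
  by rewrite ReJ_add zc; field.
have [t0 _ _ _] := on_arc_reduced xa.
have w3 : (3 <= 2 * h)%N by lia.
have H := has_sum_coprime t0 w3.
have sw : cancel (fun p : int * int => (p.2, p.1)) (fun p : int * int => (p.2, p.1)) by case.
have H1 := has_sum_perm sw sw (has_sum_conj H).
have H2 := has_sumZ (expi x ^+ (2 * h)) H.
have E : (2 * eisenstein (2 * h) (expi x))^*%C =
    expi x ^+ (2 * h) * (2 * eisenstein (2 * h) (expi x)).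
  apply: has_sum_unique H1 _; apply: eq_has_sum H2 => -[a b].
  rewrite /coprime_term /= coprimez_sym; case: ifP => _; last by rewrite conjc0 mulr0.
  have e : (latt (expi x) (b, a))^*%C = (expi x)^-1 * latt (expi x) (a, b).
    rewrite /latt rmorphD rmorphM /= conj_expi !rmorph_int mulrDr mulrCA.
    by rewrite mulVf ?expi_neq0 // mulr1 addrC mulrC.
  by rewrite conjc_inv rmorphXn /= e exprMn invfM exprVn invrK.
rewrite /z /arc_eisenstein rmorphM rmorphXn /= conj_expi.
have {}E : (eisenstein (2 * h) (expi x))^*%C =
    expi x ^+ (2 * h) * eisenstein (2 * h) (expi x).
  apply: (@mulfI _ 2); first by rewrite pnatr_eq0.
  by rewrite [RHS]mulrCA -E -(conjc_nat R 2) -(rmorphM (@conjc R)) conjc_nat.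
rewrite E mulrA; congr (_ * _).
by rewrite mul2n -addnn exprD mulrA exprVn mulVf ?mul1r // expf_neq0 // expi_neq0.
Qed.

(** The four pairs on the axes give the cosine, the two diagonal ones give [diag_term]; every other
    coprime pair has both coordinates nonzero. *)
Definition axis_diag : seq (int * int) :=
  [:: (1, 0); (-1, 0); (0, 1); (0, -1); (1, 1); (-1, -1)].

(** Half the bound of [sum_offdiag], because of the factor 1/2 in the Eisenstein series. *)
Definition arc_error h : R :=
  quadrant_sum R h - 1 + 2 ^- h * quadrant_sum R h.

Lemma expi_half_sum h x : on_arc x ->
  expi x ^+ h * (\sum_(p <- axis_diag) coprime_term (expi x) (2 * h) p) =
  2 * (2 * cos (h%:R * x) + diag_term h x)%:C.
Proof.
move=> xa; have e0 := expi_neq0 x.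
have c0 : 2 + 2 * cos x != 0.
  by have /andP[c1 c2] := on_arc_cos xa; rewrite gt_eqF //; lra.
have even_pow (u : C) : (- u) ^- (2 * h) = u ^- (2 * h) by rewrite !exprM sqrrN.
rewrite /axis_diag !big_cons big_nil addr0 /coprime_term /= /latt /=.
rewrite !(mul0r, mul1r, addr0, add0r) !mulN1r -opprD !even_pow.
have sq : (expi x + 1) ^+ 2 = expi x * (2 + 2 * cos x)%:C.
  rewrite rmorphD /= -expi_addV rmorph_nat; field; exact: e0.
rewrite [(expi x + 1) ^+ _]exprM sq exprMn invfM expr1n invr1.
have -> : (2 * cos (h%:R * x) + diag_term h x)%:C =
   expi x ^+ h + expi x ^- h + (2 + 2 * cos x)%:C ^- h.
  by rewrite rmorphD /= -expi_addV -expiX /diag_term -!rmorphXn -fmorphV.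
have -> : expi x ^+ (2 * h) = expi x ^+ h * expi x ^+ h by rewrite -exprD addnn mul2n.
have u0 : expi x ^+ h != 0 by rewrite expf_neq0.
by move: (((2 + 2 * cos x)%:C : C) ^- h) (expi x ^+ h) u0 => V u u0; field.
Qed.

Lemma arc_eisenstein_estimate h x : on_arc x -> (2 <= h)%N ->
  `|Re (arc_eisenstein h x) - (2 * cos (h%:R * x) + diag_term h x)| <= arc_error h.
Proof.
move=> xa h2; have [t0 _ _ _] := on_arc_reduced xa.
have w3 : (3 <= 2 * h)%N by lia.
have H := has_sum_coprime t0 w3.
set f := coprime_term _ _ in H.
have uA : uniq axis_diag by [].
pose g p := if p \in axis_diag then f p else 0.
have Hg : has_sum g (\sum_(p <- axis_diag) f p).
  have -> : \sum_(p <- axis_diag) f p = \sum_(p <- axis_diag) g p.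
    by rewrite big_seq [RHS]big_seq; apply: eq_bigr => p; rewrite /g => ->.
  by apply: has_sum_finite => // p; rewrite /g => /negbTE ->.
have Hr := has_sumB H Hg.
have M : abs_le (fun p => f p - g p) (2 * arc_error h).
  move=> s us.
  pose P := fun p : int * int => coprimez p.1 p.2 && (p \notin axis_diag).
  apply: (@le_trans _ _ (\sum_(p <- [seq p <- s | P p]) offdiag_weight R h p)).
    rewrite big_filter [leRHS]big_mkcond; apply: ler_sum => p _.
    rewrite /g /P; case: (boolP (p \in axis_diag)) => pA.
      by rewrite subrr cabs0 andbF.
    rewrite subr0 andbT /f /coprime_term; case: ifP => cp; last by rewrite cabs0.
    have [p1 p2] : p.1 != 0 /\ p.2 != 0.
      split; apply: contraNneq pA => p0; case: p p0 cp => a b /= ->.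
        rewrite /coprimez gcd0z eqz_nat => hb.
        by have [-> | ->] : b = 1 \/ b = -1 by lia.
      rewrite /coprimez gcdz0 eqz_nat => hb.
      by have [-> | ->] : a = 1 \/ a = -1 by lia.
    exact: latt_offdiag_le.
  apply: sum_offdiag => //; first exact: filter_uniq.
  move=> p; rewrite mem_filter => /andP[/andP[cp pA] _].
  have [p1 p2] : p.1 != 0 /\ p.2 != 0.
    split; apply: contraNneq pA => p0; case: p p0 cp => a b /= ->.
      rewrite /coprimez gcd0z eqz_nat => hb.
      by have [-> | ->] : b = 1 \/ b = -1 by lia.
    rewrite /coprimez gcdz0 eqz_nat => hb.
    by have [-> | ->] : a = 1 \/ a = -1 by lia.
  by split => //; apply: contraNneq pA => ->.
have := has_sum_le M Hr.
set r := _ - _ => hr.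
have E : arc_eisenstein h x - (2 * cos (h%:R * x) + diag_term h x)%:C =
    2^-1 * (expi x ^+ h * r).
  apply: (@mulfI _ 2); first by rewrite pnatr_eq0.
  rewrite [RHS]mulrA divff ?pnatr_eq0 // mul1r /r !mulrBr expi_half_sum //.
  by rewrite /arc_eisenstein; ring.
have -> : Re (arc_eisenstein h x) - (2 * cos (h%:R * x) + diag_term h x) =
    Re (2^-1 * (expi x ^+ h * r)).
  by rewrite -E raddfB.
apply: (le_trans (ge_cabs_Re _)).
rewrite !cabsM cabsX cabs_expi expr1n mul1r cabsV -(rmorph_nat (real_complex R)).
by rewrite cabs_real ger0_norm // mulrC ler_pdivrMr // mulrC.
Qed.

Lemma arc_error_le h : (5 <= h)%N -> arc_error h <= 6 / 25.
Proof.
move=> h5; rewrite /arc_error /quadrant_sum; set e : R := 2 ^- h.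
have e0 : 0 < e by rewrite invr_gt0 exprn_gt0.
have e1 : e <= 1 / 32.
  rewrite mul1r /e lef_pV2 ?posrE ?exprn_gt0 //.
  by rewrite -natrX ler_nat (@leq_trans (2 ^ 5)%N) // leq_exp2l.
nra.
Qed.

Lemma arc_error_le8 h : (8 <= h)%N -> arc_error h <= 3 / 100.
Proof.
move=> h8; rewrite /arc_error /quadrant_sum; set e : R := 2 ^- h.
have e0 : 0 < e by rewrite invr_gt0 exprn_gt0.
have e1 : e <= 1 / 256.
  rewrite mul1r /e lef_pV2 ?posrE ?exprn_gt0 //.
  by rewrite -natrX ler_nat (@leq_trans (2 ^ 8)%N) // leq_exp2l.
nra.
Qed.

End UnitArc.

(** * Continuity and sign changes *)

Section Continuity.
Variable R : realType.
Local Notation C := R[i].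

(** The mechanism of the Weierstrass test: a finite set whose [b]-sum is within [e] of the supremum
    serves all families dominated by [b] at once. *)
Lemma uniform_tail (I : choiceType) (b : I -> R) M e : (forall i, 0 <= b i) ->
  (forall s, uniq s -> \sum_(i <- s) b i <= M) -> 0 < e ->
  exists A : seq I, forall (g : I -> C) l, (forall i, cabs (g i) <= b i) ->
    has_sum g l -> cabs (l - \sum_(i <- A) g i) <= e.
Proof.
move=> b0 bM e0; pose E : set R := [set r | exists2 s : seq I, uniq s & r = \sum_(i <- s) b i].
have supE : has_sup E.
  split; first by exists 0, [::] => //; rewrite big_nil.
  by exists M => _ [s us ->]; exact: bM.
have [_ [A uA ->] HA] := sup_adherent e0 supE.
exists A => g l gb gl.
have HgA : has_sum (fun i => if i \in A then g i else 0) (\sum_(i <- A) g i).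
  have -> : \sum_(i <- A) g i = \sum_(i <- A) (if i \in A then g i else 0).
    by rewrite big_seq [RHS]big_seq; apply: eq_bigr => i ->.
  by apply: has_sum_finite => // i /negbTE ->.
apply: has_sum_le (has_sumB gl HgA) => s us.
apply: (@le_trans _ _ (\sum_(i <- [seq i <- s | i \notin A]) b i)).
  rewrite big_filter [leRHS]big_mkcond; apply: ler_sum => i _.
  by case: (boolP (i \in A)) => iA /=; rewrite ?subrr ?cabs0 // subr0.
have : \sum_(i <- A ++ [seq i <- s | i \notin A]) b i <= sup E.
  apply: ub_le_sup; first by case: supE.
  eexists; last by [].
  rewrite cat_uniq uA filter_uniq // andbT; apply/hasPn => i.
  by rewrite mem_filter => /andP[].
by rewrite big_cat /=; lra.
Qed.

Definition ccontinuous (f : R -> C) (x : R) :=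
  {for x, continuous (fun y => Re (f y))} /\ {for x, continuous (fun y => Im (f y))}.

Lemma ccontinuousD f g x : ccontinuous f x -> ccontinuous g x ->
  ccontinuous (fun y => f y + g y) x.
Proof.
move=> [f1 f2] [g1 g2]; split.
  rewrite (_ : (fun _ => _) = (fun y => Re (f y) + Re (g y))).
    exact: cvgD.
  by apply/funext => y; rewrite raddfD.
rewrite (_ : (fun _ => _) = (fun y => Im (f y) + Im (g y))).
  exact: cvgD.
by apply/funext => y; rewrite raddfD.
Qed.

Lemma ccontinuousM f g x : ccontinuous f x -> ccontinuous g x ->
  ccontinuous (fun y => f y * g y) x.
Proof.
move=> [f1 f2] [g1 g2]; split.
  rewrite (_ : (fun _ => _) = (fun y => Re (f y) * Re (g y) - Im (f y) * Im (g y))).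
    by apply: cvgB; exact: cvgM.
  by apply/funext => y; case: (f y) (g y) => ? ? [].
rewrite (_ : (fun _ => _) = (fun y => Re (f y) * Im (g y) + Im (f y) * Re (g y))).
  by apply: cvgD; exact: cvgM.
by apply/funext => y; case: (f y) (g y) => ? ? [].
Qed.

Lemma ccontinuous_cst (c : C) x : ccontinuous (fun=> c) x.
Proof. by split; exact: cvg_cst. Qed.

Lemma ccontinuousX f n x : ccontinuous f x -> ccontinuous (fun y => f y ^+ n) x.
Proof.
move=> cf; elim: n => [|n IH]; first exact: ccontinuous_cst.
rewrite (_ : (fun _ => _) = (fun y => f y * f y ^+ n)).
  exact: ccontinuousM.
by apply/funext => y; rewrite exprS.
Qed.

Lemma ccontinuousV f x : ccontinuous f x -> f x != 0 ->
  ccontinuous (fun y => (f y)^-1) x.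
Proof.
move=> [f1 f2] fx.
have n0 : Re (f x) ^+ 2 + Im (f x) ^+ 2 != 0.
  by rewrite -cabs_sqr expf_neq0 // cabs_eq0.
have cn : {for x, continuous (fun y => (Re (f y) ^+ 2 + Im (f y) ^+ 2)^-1)}.
  apply: cvgV => //; apply: cvgD.
    by rewrite /= expr2; exact: cvgM.
  by rewrite /= expr2; exact: cvgM.
split.
  rewrite (_ : (fun _ => _) = (fun y => Re (f y) * (Re (f y) ^+ 2 + Im (f y) ^+ 2)^-1)).
    exact: cvgM.
  by apply/funext => y; case: (f y).
rewrite (_ : (fun _ => _) = (fun y => - (Im (f y) * (Re (f y) ^+ 2 + Im (f y) ^+ 2)^-1))).
  by apply: cvgN; exact: cvgM.
by apply/funext => y; case: (f y).
Qed.

Lemma ccontinuous_sum (I : Type) (s : seq I) (F : I -> R -> C) x :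
  (forall i, ccontinuous (F i) x) -> ccontinuous (fun y => \sum_(i <- s) F i y) x.
Proof.
move=> cF; elim: s => [|i s IH].
  rewrite (_ : (fun _ => _) = (fun=> 0)); first exact: ccontinuous_cst.
  by apply/funext => y; rewrite big_nil.
rewrite (_ : (fun _ => _) = (fun y => F i y + \sum_(i <- s) F i y)).
  exact: ccontinuousD.
by apply/funext => y; rewrite big_cons.
Qed.

Lemma ccontinuous_expi x : ccontinuous (@expi R) x.
Proof. by split; [exact: continuous_cos | exact: continuous_sin]. Qed.

Lemma ccontinuous_coprime_term w p x : on_arc x ->
  ccontinuous (fun y => coprime_term (expi y) w p) x.
Proof.
move=> xa; rewrite /coprime_term; case cp: (coprimez p.1 p.2); last exact: ccontinuous_cst.
have [t0 _ _ _] := on_arc_reduced xa.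
apply: ccontinuousV; last first.
  rewrite expf_neq0 // latt_eq0 //; apply/eqP => p0.
  by move: cp; rewrite p0 /coprimez gcdz0.
apply: ccontinuousX; rewrite /latt; apply: ccontinuousD; last exact: ccontinuous_cst.
by apply: ccontinuousM; [exact: ccontinuous_cst | exact: ccontinuous_expi].
Qed.

Lemma within_continuous_approx (D : set R) (f : R -> R) :
  (forall e : R, 0 < e -> exists2 g : R -> R, forall x, D x -> {for x, continuous g} &
     forall x, D x -> `|f x - g x| <= e) ->
  {within D, continuous f}.
Proof.
move=> H; apply/subspace_continuousP => x Dx; apply/cvgrPdist_lt => e e0.
have e4 : 0 < e / 4 by rewrite divr_gt0.
have [g cg fg] := H _ e4.
have /cvgrPdist_lt/(_ _ e4) gx := cg x Dx.
rewrite /prop_near1 /within /nbhs /=.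
near=> y => Dy.
have h1 := fg x Dx; have h2 := fg y Dy.
have h3 : `|g x - g y| < e / 4 by near: y.
have -> : f x - f y = (f x - g x) + (g x - g y) - (f y - g y) by ring.
rewrite (le_lt_trans (ler_normB _ _)) //.
have := ler_normD (f x - g x) (g x - g y); lra.
Unshelve. all: by end_near.
Qed.

Lemma arc_eisenstein_continuous h : (2 <= h)%N ->
  {within [set` `[pi / 2, 2 * pi / 3]], continuous (fun x => Re (arc_eisenstein h x) : R)}.
Proof.
move=> h2; apply: within_continuous_approx => e e0.
have w3 : (3 <= 2 * h)%N by lia.
pose b (p : int * int) := root_weight R `|p.1| ^+ (2 * h) * root_weight R `|p.2| ^+ (2 * h).
have rw n : 0 <= root_weight R n ^+ (2 * h) by rewrite exprn_ge0 // ltW // root_weight_gt0.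
have bM s : uniq s -> \sum_(p <- s) b p <= (4 + 4) * (4 + 4).
  apply: (ler_sum_prod (F := b) (a := fun n : int => root_weight R `|n| ^+ (2 * h))
    (b := fun n : int => root_weight R `|n| ^+ (2 * h))) => //.
  - by apply: (sum_int_le (u := fun n => root_weight R n ^+ (2 * h))) => // t ut; exact: sum_root_weight.
  - by apply: (sum_int_le (u := fun n => root_weight R n ^+ (2 * h))) => // t ut; exact: sum_root_weight.
have b0 p : 0 <= b p by rewrite mulr_ge0.
have [A HA] := uniform_tail b0 bM e0.
exists (fun x => Re (2^-1 * (expi x ^+ h *
   \sum_(p <- A) coprime_term (expi x) (2 * h) p))) => x; rewrite /= in_itv /= => xa.
  have [+ _] : ccontinuous (fun x => 2^-1 * (expi x ^+ h *
     \sum_(p <- A) coprime_term (expi x) (2 * h) p)) x; last by [].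
  apply: ccontinuousM; first exact: ccontinuous_cst.
  apply: ccontinuousM; first by apply: ccontinuousX; exact: ccontinuous_expi.
  by apply: ccontinuous_sum => p; exact: ccontinuous_coprime_term.
have [t0 _ _ _] := on_arc_reduced xa.
have := HA (coprime_term (expi x) (2 * h)) _ _ (has_sum_coprime t0 w3).
move=> /(_ _)/wrap[p|H].
  rewrite /coprime_term; case: ifP => _; last by rewrite cabs0.
  have := @latt_term_le R (expi x) 1 (2 * h) p _ ler01 (latt_bound_arc xa).
  by rewrite expr1n mul1r; apply; lia.
rewrite -raddfB /= (le_trans (ge_cabs_Re _)) //.
set S := \sum_(p <- A) _ in H *.
have -> : arc_eisenstein h x - 2^-1 * (expi x ^+ h * S) =
    2^-1 * (expi x ^+ h * (2 * eisenstein (2 * h) (expi x) - S)).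
  by rewrite /arc_eisenstein; field.
have half : cabs (2^-1 : C) = 2^-1.
  by rewrite cabsV -(rmorph_nat (real_complex R)) cabs_real ger0_norm.
rewrite !cabsM cabsX cabs_expi expr1n mul1r half.
have := cabs_ge0 (2 * eisenstein (2 * h) (expi x) - S).
by move: H; set u := cabs _; lra.
Qed.

(** Strict signs at the nodes put each zero strictly between two consecutive nodes, so the zeros are
    distinct. The offset [m0] aligns the sign exponent with the index of the sample point. *)
Lemma sign_changes (D : set R) (f : R -> R) (x : nat -> R) n m0 :
  (forall i j, (i <= j <= n)%N -> `[x i, x j] `<=` D) ->
  {within D, continuous f} ->
  (forall i, (i < n)%N -> x i < x i.+1) ->
  (forall i, (i <= n)%N -> 0 < (-1) ^+ (m0 + i) * f (x i)) ->
  exists s : seq R, [/\ uniq s, size s = n &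
    forall z, z \in s -> x 0%N < z < x n /\ f z = 0].
Proof.
move=> xD fc; elim: n xD => [|n IH] xD xi fs; first by exists [::].
have [|i ni|i ni|s [us ss Hs]] := IH.
- by move=> i j ij; apply: xD; lia.
- by apply: xi; lia.
- by apply: fs; lia.
have x0n : x 0%N <= x n.
  have : forall i, (i <= n)%N -> x 0%N <= x i.
    elim=> [//|i IHi] hi; rewrite (le_trans (IHi _)) ?ltW ?xi //; lia.
  exact.
have xn : x n < x n.+1 by exact: xi.
have f1 := fs n (leqnSn n); have f2 := fs n.+1 (leqnn _).
have [c] : exists2 c, c \in `[x n, x n.+1] & f c = 0.
  apply: IVT; first exact: ltW.
    by apply: continuous_subspaceW fc; apply: xD; lia.
  move: f1 f2; rewrite addnS exprS mulN1r mulNr oppr_gt0 -signr_odd.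
  by case: odd => /=; rewrite ?expr1 ?mulN1r ?expr0 ?mul1r ?oppr_gt0 ?oppr_lt0 => f1 f2;
     rewrite ge_min le_max (ltW f1) (ltW f2) ?orbT.
rewrite in_itv /= => /andP[c1 c2] fc0.
have c1' : x n < c.
  by rewrite lt_neqAle c1 andbT; apply/eqP => h; move: f1; rewrite h fc0 mulr0 ltxx.
have c2' : c < x n.+1.
  by rewrite lt_neqAle c2 andbT; apply/eqP => h; move: f2; rewrite -h fc0 mulr0 ltxx.
exists (c :: s); split => /=; [|by rewrite ss|].
  rewrite us andbT; apply/negP => /Hs[/andP[_ h] _].
  by have := lt_trans h c1'; rewrite ltxx.
move=> z; rewrite inE => /orP[/eqP ->|/Hs[/andP[z1 z2] fz]].
  by rewrite c2' andbT (le_lt_trans x0n).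
by rewrite z1 (lt_trans z2).
Qed.

End Continuity.

(** * Signs at the sample points and the location of zeros *)

Section Zeros.
Variable R : realType.
Local Notation C := R[i].

(** The [n] zeros lie strictly between the extreme samples, hence away from [i] and [rho]; the first
    sample shows that the form is not identically zero. *)
Lemma zeros_on_arc n a b (F : C -> C) (f : R -> R) (x : nat -> R) m0 :
  (a < 3)%N -> (b < 2)%N -> isobaric_fun (12 * n + 4 * a + 6 * b) F ->
  (forall y, on_arc y -> (F (expi y) = 0 <-> f y = 0)) ->
  {within [set` `[pi / 2, 2 * pi / 3]], continuous f} ->
  (forall i, (i <= n)%N -> on_arc (x i)) ->
  (forall i, (i < n)%N -> x i < x i.+1) ->
  (forall i, (i <= n)%N -> 0 < (-1) ^+ (m0 + i) * f (x i)) ->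
  forall tau, fundamental_domain tau -> F tau = 0 -> unit_arc tau.
Proof.
move=> a3 b2 HF Ff fc xa xi fs tau /fundamental_domain_reduced rt Ft.
have [|s [us ss Hs]] := sign_changes _ fc xi fs.
  move=> i j ij z; rewrite /= !in_itv /= => /andP[z1 z2].
  have /andP[h1 _] : on_arc (x i) by apply: xa; lia.
  have /andP[_ h2] : on_arc (x j) by apply: xa; lia.
  by rewrite (le_trans h1 z1) (le_trans z2 h2).
have /andP[a1 a2] := xa 0%N (leq0n _); have /andP[a3' a4] := xa n (leqnn _).
have sa z : z \in s -> pi / 2 < z < 2 * pi / 3.
  move=> /Hs[/andP[z1 z2] _]; apply/andP; split; first exact: le_lt_trans z1.
  exact: lt_le_trans z2 a4.
have sarc z : z \in s -> on_arc z.
  by move=> /sa/andP[z1 z2]; rewrite /on_arc !ltW.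
have itv z : on_arc z -> z \in `[0, pi] by move=> /on_arc_bounds; rewrite in_itv.
have p0 := pi_gt0 R.
have iarc y : on_arc y -> pi / 2 < y < 2 * pi / 3 -> expi y != rho R /\ expi y != 'i%C.
  move=> ya /andP[y1 y2]; split; apply/eqP => /(congr1 (fun u : C => Re u)) /=.
    rewrite -cos_2pi3 => /cos_inj; rewrite itv // in_itv /= => /(_ isT) h.
    by move: y2; rewrite h ?ltxx //; apply/andP; split; lra.
  rewrite -(@cos_pihalf R) => /cos_inj; rewrite itv // in_itv /= => /(_ isT) h.
  by move: y1; rewrite h ?ltxx //; apply/andP; split; lra.
have uexp : uniq (map (@expi R) s).
  rewrite map_inj_in_uniq // => y z ys zs E.
  apply: cos_inj; rewrite ?itv ?sarc //.
  by have := congr1 (fun u : C => Re u) E.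
have sexp : size (map (@expi R) s) = n by rewrite size_map.
have zexp t : t \in map (@expi R) s -> [/\ reduced t, t != rho R, t != 'i%C & F t = 0].
  move=> /mapP[y ys ->]; have ya := sarc y ys.
  have [h1 h2] := iarc y ya (sa y ys); split => //; first exact: on_arc_reduced.
  by apply/(Ff y ya); have [] := Hs y ys.
have x0 := xa 0%N (leq0n _).
have F0 : F (expi (x 0%N)) != 0.
  apply/eqP => /(Ff _ x0) h; have := fs 0%N (leq0n _).
  by rewrite h mulr0 ltxx.
have [/mapP[y ys ->]|->|->] :=
  reduced_zeros a3 b2 HF uexp sexp zexp (on_arc_reduced x0) F0 rt Ft.
- by apply: arc_unit_arc; exact: sarc.
- exact: rho_unit_arc.
- exact: i_unit_arc.
Qed.

Definition power_sum_form e h (tau : C) : C :=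
  eisenstein (2 * h) tau ^+ e + eisenstein (e * (2 * h)) tau.

Definition arc_form e h (y : R) : R :=
  Re (arc_eisenstein h y) ^+ e + Re (arc_eisenstein (e * h) y).

Lemma arc_form_eq0 e h y : on_arc y -> (2 <= h)%N -> (0 < e)%N ->
  power_sum_form e h (expi y) = 0 <-> arc_form e h y = 0.
Proof.
move=> ya h2 e0.
have E : expi y ^+ (e * h) * power_sum_form e h (expi y) = (arc_form e h y)%:C.
  rewrite /arc_form rmorphD rmorphXn /= -!arc_eisenstein_real //; last by nia.
  rewrite /arc_eisenstein /power_sum_form mulrDr; congr (_ + _).
    by rewrite [RHS]exprMn mulnC exprM.
  by rewrite [(2 * (e * h))%N]mulnCA.
split=> H0; first by apply: complexI; rewrite -E H0 mulr0.
move: E; rewrite H0 => /eqP; rewrite mulf_eq0 expf_eq0 (negbTE (expi_neq0 y)) andbF /=.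
by move=> /eqP.
Qed.

Lemma cvg_power (T : Type) (G : set_system T) {FG : Filter G} (g : T -> R) (l : R) n :
  g @ G --> l -> (fun x => g x ^+ n) @ G --> l ^+ n.
Proof.
move=> gl; elim: n => [|n IH]; first exact: cvg_cst.
rewrite exprS (_ : (fun _ => _) = (fun x => g x * g x ^+ n)); first exact: cvgM.
by apply/funext => x; rewrite exprS.
Qed.

Lemma arc_form_continuous e h : (2 <= h)%N -> (0 < e)%N ->
  {within [set` `[pi / 2, 2 * pi / 3]], continuous (arc_form e h)}.
Proof.
move=> h2 e0 y; apply: cvgD; last by apply: arc_eisenstein_continuous; nia.
by apply: cvg_power; exact: arc_eisenstein_continuous.
Qed.

Lemma power_sum_form_isobaric e h : (2 <= h)%N -> (0 < e)%N ->
  isobaric_fun (e * (2 * h)) (power_sum_form e h).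
Proof.
move=> h2 e0.
have [||f Hf fE] := @eisenstein_isobaric R (2 * h); [by lia|by rewrite mul2n odd_double|].
have [||g Hg gE] := @eisenstein_isobaric R (e * (2 * h)).
- by nia.
- by rewrite mulnCA mul2n odd_double.
exists (fun x y => f x y ^+ e + g x y); last by move=> tau t0; rewrite /power_sum_form fE // gE.
by apply: isobaricD => //; exact: isobaricXn.
Qed.

Lemma diag_term_bounds h (y : R) : on_arc y -> 0 <= diag_term h y <= 1.
Proof.
move=> ya; have /andP[c1 _] := on_arc_cos ya.
have h1 : 1 <= 2 + 2 * cos y by lra.
rewrite /diag_term invr_ge0 exprn_ge0 ?invf_le1 ?exprn_ege1 ?exprn_gt0 //; lra.
Qed.

Lemma diag_termX e h (y : R) : diag_term (e * h) y = diag_term h y ^+ e.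
Proof. by rewrite /diag_term mulnC exprM exprVn. Qed.

Lemma arc_form_expand e h (y : R) : on_arc y -> (2 <= h)%N -> (0 < e)%N -> exists S S' : R,
  [/\ `|S| <= arc_error R h, `|S'| <= arc_error R (e * h) &
   arc_form e h y = (2 * cos (h%:R * y) + diag_term h y + S) ^+ e +
     (2 * cos (e%:R * (h%:R * y)) + diag_term h y ^+ e + S')].
Proof.
move=> ya h2 e0; have eh2 : (2 <= e * h)%N by nia.
have H1 := arc_eisenstein_estimate ya h2.
have H2 := arc_eisenstein_estimate ya eh2.
do 2 eexists; split; [exact: H1 | exact: H2 |].
by rewrite /arc_form diag_termX mulrA -natrM; congr (_ ^+ e + _); ring.
Qed.

Definition sample e h m : R := m%:R * (pi / (e * h)%:R).

Lemma sample_lt e h m : (0 < e * h)%N -> sample e h m < sample e h m.+1.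
Proof.
by move=> eh; rewrite /sample ltr_pM2r ?ltr_nat // divr_gt0 ?pi_gt0 // ltr0n.
Qed.

Lemma sample_on_arc e h m : (0 < e * h)%N -> (e * h <= 2 * m)%N -> (3 * m <= 2 * (e * h))%N ->
  on_arc (sample e h m).
Proof.
move=> eh h1 h2; have p0 := pi_gt0 R; rewrite /on_arc /sample.
have n0 : 0 < (e * h)%:R :> R by rewrite ltr0n.
move: h1 h2; rewrite -(ler_nat R) -[(3 * m <= _)%N](ler_nat R) !natrM.
rewrite -natrM; move: ((e * h)%:R) n0 => k k0 h1 h2.
have -> : m%:R * (pi / k) = pi * (m%:R / k) by ring.
have a1 : 2^-1 <= m%:R / k by rewrite ler_pdivlMr //; lra.
have a2 : m%:R / k <= 2 / 3 by rewrite ler_pdivrMr //; lra.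
have := ler_wpM2l (ltW p0) a1; have := ler_wpM2l (ltW p0) a2.
by move=> b1 b2; apply/andP; split; lra.
Qed.

Lemma sample_mul e h m : (0 < e * h)%N -> e%:R * (h%:R * sample e h m) = m%:R * pi.
Proof.
move=> eh; rewrite mulrA -natrM /sample mulrCA; congr (_ * _).
by rewrite mulrC divfK // pnatr_eq0 -lt0n.
Qed.

Lemma cos_sample e h m : (0 < e * h)%N ->
  cos (e%:R * (h%:R * sample e h m)) = (-1) ^+ m.
Proof. by move=> eh; rewrite sample_mul // cos_natpi. Qed.

(** The arithmetic hypothesis is the conclusion divided by [pi] and cleared of denominators. *)
Lemma sample_diag_le e h m N : (0 < e * h)%N -> (0 < N)%N ->
  (3 * m * N + e * h <= 2 * (e * h) * N)%N ->
  sample e h m <= 2 * (pi / 3 - pi / 6 / N%:R).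
Proof.
move=> eh N0 H0.
have H : 3 * m%:R * N%:R + (e * h)%:R <= 2 * (e * h)%:R * N%:R :> R.
  by rewrite -!natrM -natrD ler_nat.
have p0 := pi_gt0 R; have k0 : 0 < (e * h)%:R :> R by rewrite ltr0n.
have n0 : 0 < N%:R :> R by rewrite ltr0n.
rewrite /sample; move: ((e * h)%:R) (N%:R) (m%:R) k0 n0 H => k n x k0 n0 H.
have -> : x * (pi / k) = pi * (x / k) by ring.
have -> : 2 * (pi / 3 - pi / 6 / n) = pi * ((2 * n - 1) / (3 * n)).
  by field; rewrite gt_eqF.
rewrite ler_pM2l // ler_pdivrMr // mulrAC ler_pdivlMr ?mulr_gt0 //; lra.
Qed.

(** Bernoulli's inequality: the power is at least [1 + 41/50 = 91/50]. *)
Lemma square_diag_bound N : (8 <= N)%N -> (1 + 41 / 50 / N%:R) ^- N <= 50 / 91 :> R.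
Proof.
move=> N8; have n8 : 8 <= N%:R :> R by rewrite (ler_nat _ 8).
have n0 : 0 < N%:R :> R by lra.
have t0 : 0 <= 41 / 50 / N%:R :> R by rewrite !divr_ge0 // ltW.
have B : 91 / 50 <= (1 + 41 / 50 / N%:R) ^+ N :> R.
  apply: le_trans (binomial3_le _ t0).
  move: (N%:R) n0 n8 t0 => k n0 n8 t0.
  have e1 : k * (41 / 50 / k) = 41 / 50 by rewrite mulrC divfK // gt_eqF.
  have : 0 <= k * (k - 1) / 2 * (41 / 50 / k) ^+ 2.
    by rewrite mulr_ge0 ?exprn_ge0 ?divr_ge0 ?mulr_ge0 //; lra.
  have : 0 <= k * (k - 1) * (k - 2) / 6 * (41 / 50 / k) ^+ 3.
    by rewrite mulr_ge0 ?exprn_ge0 ?divr_ge0 ?mulr_ge0 //; lra.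
  by rewrite e1; move: (_ ^+ 2) (_ ^+ 3) => u v; lra.
have -> : 50 / 91 = (91 / 50)^-1 :> R by field.
by rewrite lef_pV2 ?posrE //; lra.
Qed.

Lemma square_sign h m : (5 <= h)%N -> (h <= m)%N -> (3 * m <= 4 * h)%N ->
  0 < (-1) ^+ m * arc_form 2 h (sample 2 h m).
Proof.
move=> h5 h1 h2; have eh : (0 < 2 * h)%N by lia.
have ya : on_arc (sample 2 h m) by apply: sample_on_arc; lia.
have [|//|S [S' [HS HS' ->]]] := @arc_form_expand 2 h _ ya; first by lia.
have {}HS := le_trans HS (arc_error_le R h5).
have {}HS' : `|S'| <= 6 / 25 by apply: le_trans HS' (arc_error_le R _); lia.
move: HS HS'; rewrite !ler_norml => /andP[s1 s2] /andP[s3 s4].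
have /andP[v0 v1] := diag_term_bounds h ya.
have cm := cos_sample m eh.
have [om|em] := boolP (odd m); last first.
  have sg : (-1) ^+ m = 1 :> R by rewrite -signr_odd (negbTE em).
  rewrite cm sg mul1r; set V := diag_term _ _ in v0 v1 *.
  set u := (_ + S); have := sqr_ge0 u; have := sqr_ge0 V; lra.
have sg : (-1) ^+ m = -1 :> R by rewrite -signr_odd om expr1.
have c0 : cos (h%:R * sample 2 h m) = 0.
  apply/eqP; rewrite -sqrf_eq0; apply/eqP.
  by have := cm; rewrite sg cos_mul2; lra.
rewrite c0 cm sg mulr0 add0r.
have vb : diag_term h (sample 2 h m) <= 50 / 91.
  have N8 : (8 <= 2 * h)%N by lia.
  have /andP[x0 _] := on_arc_bounds ya.
  apply: (le_trans (diag_term_le h N8 x0 _)).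
    apply: sample_diag_le; [exact: eh|exact: eh|].
    (* [3 m] is odd and [4 h] is even, so the inequality [3 m <= 4 h] is strict. *)
    have q : (3 * m + 1 <= 4 * h)%N.
      by have := odd_double_half m; rewrite om add1n => mE; clear -h2 mE; lia.
    have -> : (3 * m * (2 * h) + 2 * h = (3 * m + 1) * (2 * h))%N by rewrite mulnDl mul1n.
    by rewrite leq_mul2r mulnA q orbT.
  exact: square_diag_bound.
set V := diag_term _ _ in v0 v1 vb *.
rewrite mulN1r oppr_gt0.
(* These give [(V + S)^2 <= 64/100] and [V^2 <= V <= 50/91]; with the error 6/25 the total is about
   1.43, below 2. *)
have u1 : 0 <= (8 / 10 - (V + S)) * (8 / 10 + (V + S)) by rewrite mulr_ge0 //; lra.
have u2 : 0 <= V * (1 - V) by rewrite mulr_ge0 //; lra.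
by move: u1 u2 vb s4; clear; lra.
Qed.

(** 13/6 is chosen because [(6/13)^2 < 43/200]. At [h = 8] the expansion through the cubic term
    gives about 2.174, while the quadratic one stops near 2.114. *)
Lemma cube_diag_bound h : (8 <= h)%N -> (1 + 41 / 50 / h%:R) ^- (2 * h) <= 43 / 200 :> R.
Proof.
move=> h8; have n8 : 8 <= h%:R :> R by rewrite (ler_nat _ 8).
have n0 : 0 < h%:R :> R by lra.
have t0 : 0 <= 41 / 50 / h%:R :> R by rewrite !divr_ge0 // ltW.
have B : 13 / 6 <= (1 + 41 / 50 / h%:R) ^+ h :> R.
  apply: le_trans (binomial3_le _ t0).
  move: (h%:R) n0 n8 => k n0 n8; have k0 : k != 0 by rewrite gt_eqF.
  set u := k^-1; have u0 : 0 < u by rewrite invr_gt0.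
  have u8 : u <= 8^-1 by rewrite lef_pV2 ?posrE.
  have -> : 1 + k * (41 / 50 * u) + k * (k - 1) / 2 * (41 / 50 * u) ^+ 2 +
      k * (k - 1) * (k - 2) / 6 * (41 / 50 * u) ^+ 3 =
      1 + 41 / 50 + (41 / 50) ^+ 2 / 2 * (1 - u) + (41 / 50) ^+ 3 / 6 * ((1 - u) * (1 - 2 * u)).
    by rewrite /u; field.
  have : (1 - 8^-1) * (1 - 2 * 8^-1) <= (1 - u) * (1 - 2 * u) by apply: ler_pM; lra.
  lra.
have B0 : 0 < (1 + 41 / 50 / h%:R) ^+ h :> R by lra.
have -> : 43 / 200 = (200 / 43)^-1 :> R by field.
rewrite mulnC exprM; move: (_ ^+ h) B B0 => z B B0.
have z2 : 0 < z ^+ 2 by rewrite exprn_gt0.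
by rewrite lef_pV2 ?posrE //; nra.
Qed.

Lemma cube_sign h m : (8 <= h)%N -> (3 * h <= 2 * m)%N -> (m <= 2 * h)%N ->
  0 < (-1) ^+ m * arc_form 3 h (sample 3 h m).
Proof.
move=> h8 h1 h2; have eh : (0 < 3 * h)%N by lia.
have ya : on_arc (sample 3 h m) by apply: sample_on_arc; lia.
have [|//|S [S' [HS HS' ->]]] := @arc_form_expand 3 h _ ya; first by lia.
have {}HS := le_trans HS (arc_error_le8 R h8).
have {}HS' : `|S'| <= 3 / 100 by apply: le_trans HS' (arc_error_le8 R _); lia.
move: HS HS'; rewrite !ler_norml => /andP[s1 s2] /andP[s3 s4].
have /andP[v0 v1] := diag_term_bounds h ya.
have cm := cos_sample m eh.
have c3 : 4 * cos (h%:R * sample 3 h m) ^+ 3 - 3 * cos (h%:R * sample 3 h m) = (-1) ^+ m.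
  by rewrite -cos_mul3.
have [om|em] := boolP (odd m); last first.
  have sg : (-1) ^+ m = 1 :> R by rewrite -signr_odd (negbTE em).
  rewrite cm; move: c3; rewrite sg mul1r.
  move: (cos (h%:R * _)) (diag_term _ _) v0 v1 => c V v0 v1 c3.
  (* The triple angle has cosine 1, so [c] is 1 or -1/2; for odd [m] it is -1 or 1/2. *)
  have c1 : - 2^-1 <= c.
    have : (c - 1) * (2 * c + 1) ^+ 2 = 0.
      by transitivity (4 * c ^+ 3 - 3 * c - 1); [ring | rewrite c3 subrr].
    by move/eqP; rewrite mulf_eq0 sqrf_eq0 subr_eq0 => /orP[] /eqP e; lra.
  have V3 : 0 <= V ^+ 3 by rewrite exprn_ge0.
  have u1 : - (11 / 10) <= 2 * c + V + S by lra.
  have : - (14 / 10) <= (2 * c + V + S) ^+ 3.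
    by move: (2 * c + V + S) u1 => u u1; have [u0|u0] := leP 0 u; nra.
  lra.
have sg : (-1) ^+ m = -1 :> R by rewrite -signr_odd om expr1.
have vb : diag_term h (sample 3 h m) <= 43 / 200.
  have /andP[x0 _] := on_arc_bounds ya.
  apply: le_trans (cube_diag_bound h8); apply: diag_term_le => //.
  apply: sample_diag_le; [exact: eh|by clear -h8; lia|].
  (* An odd [m <= 2 h] is at most [2 h - 1]. *)
  have q : (3 * (m + 1) <= 2 * (3 * h))%N.
    by have := odd_double_half m; rewrite om add1n => mE; clear -h2 mE; lia.
  have -> : (3 * m * h + 3 * h = 3 * (m + 1) * h)%N by rewrite mulnDr mulnDl muln1.
  by rewrite leq_mul2r q orbT.
rewrite cm; move: c3; rewrite sg mulN1r oppr_gt0.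
move: (cos (h%:R * _)) (diag_term _ _) v0 v1 vb => c V v0 v1 vb c3.
have c1 : c <= 2^-1.
  have : (c + 1) * (2 * c - 1) ^+ 2 = 0.
    by transitivity (4 * c ^+ 3 - 3 * c + 1); [ring | rewrite c3 addNr].
  by move/eqP; rewrite mulf_eq0 sqrf_eq0 subr_eq0 addr_eq0 => /orP[] /eqP e; lra.
have V3 : V ^+ 3 <= (1 / 4) ^+ 3.
  by apply: lerXn2r; rewrite ?nnegrE; clear -v0 vb; lra.
(* [1 + 43/200 + 3/100 < 5/4], and [(5/4)^3 + (1/4)^3 + 3/100 = 1.99875 < 2]: the narrow margin
   behind the choice of constants. *)
have u1 : 2 * c + V + S <= 5 / 4 by lra.
have : (2 * c + V + S) ^+ 3 <= (5 / 4) ^+ 3.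
  move: (2 * c + V + S) u1 => u u1; have [u0|u0] := leP 0 u.
    by apply: lerXn2r; rewrite ?nnegrE; clear -u0 u1; lra.
  apply: (@le_trans _ _ 0); first by rewrite exprn_odd_le0 // ltW.
  by rewrite exprn_ge0 ?divr_ge0.
lra.
Qed.

End Zeros.

Local Close Scope complex_scope.

Theorem theorem1p1 (R : realType) (k : nat) (k_even : ~~ odd k) :
  ((10 <= k)%N -> forall tau : R[i], fundamental_domain tau ->
     eisenstein k tau ^+ 2 + eisenstein (2 * k) tau = 0 -> unit_arc tau) /\
  ((16 <= k)%N -> forall tau : R[i], fundamental_domain tau ->
     eisenstein k tau ^+ 3 + eisenstein (3 * k) tau = 0 -> unit_arc tau).
Proof.
have [h kE] : exists h, k = (2 * h)%N.
  by exists k./2; rewrite mul2n -[LHS]odd_double_half (negbTE k_even).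
rewrite kE; split=> kh tau.
  have h5 : (5 <= h)%N by lia.
  (* The weight is [4 h], so [h %/ 3] zeros are required; the samples [m = h, ..., h + h %/ 3] start
     at the point [i]. *)
  have HF : isobaric_fun (12 * (h %/ 3) + 4 * (h %% 3) + 6 * 0) (@power_sum_form R 2 h).
    have -> : (12 * (h %/ 3) + 4 * (h %% 3) + 6 * 0 = 2 * (2 * h))%N by lia.
    by apply: power_sum_form_isobaric; lia.
  apply: (zeros_on_arc (f := arc_form 2 h) (x := fun i => sample R 2 h (h + i)) (m0 := h)
    (ltn_pmod h (isT : (0 < 3)%N)) (isT : (0 < 2)%N) HF).
  - by move=> y ya; apply: arc_form_eq0 => //; lia.
  - by apply: arc_form_continuous; lia.
  - by move=> i hi; apply: sample_on_arc; lia.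
  - by move=> i hi; rewrite addnS; apply: sample_lt; lia.
  - by move=> i hi; apply: square_sign; lia.
have h8 : (8 <= h)%N by lia.
have HF : isobaric_fun (12 * (h %/ 2) + 4 * 0 + 6 * (h %% 2)) (@power_sum_form R 3 h).
  have -> : (12 * (h %/ 2) + 4 * 0 + 6 * (h %% 2) = 3 * (2 * h))%N by lia.
  by apply: power_sum_form_isobaric; lia.
(* The weight is [6 h], so [h %/ 2] zeros are required; this start makes the last sample [m = 2 h],
   which is [rho]. *)
pose m0 := (2 * h - h %/ 2)%N.
apply: (zeros_on_arc (f := arc_form 3 h) (x := fun i => sample R 3 h (m0 + i)) (m0 := m0)
  (isT : (0 < 3)%N) (ltn_pmod h (isT : (0 < 2)%N)) HF).
- by move=> y ya; apply: arc_form_eq0 => //; lia.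
- by apply: arc_form_continuous; lia.
- by move=> i hi; apply: sample_on_arc; rewrite /m0; lia.
- by move=> i hi; rewrite addnS; apply: sample_lt; lia.
- by move=> i hi; apply: cube_sign; rewrite /m0; lia.
Qed.
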